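(* Let $\mathscr{A}$ be a unital $C^*$-algebra, $\mathscr{E}$ a Hilbert $\mathscr{A}$-module, $\mathscr{E}_1,\mathscr{E}_2$ ternary subspaces of $\mathscr{E}$, and $\mathscr{A}_i=\langle\mathscr{E}_i,\mathscr{E}_i\rangle$ for $i=1,2$. Let $z_i\in\mathscr{E}_i$ be such that $|z_i|a_i=a_i$ for all $a_i\in\mathscr{A}_i$ ($i=1,2$). Then $\mathscr{E}_1$ and $\mathscr{E}_2$ are module independent if and only if there are positive constants $m$ and $M$ such that for all norm-one elements $x_i\in\mathscr{E}_i$ ($i=1,2$) there is $\varphi\in S(\mathscr{A})$ such that $$m\le\varphi(|x_i|)=\varphi(|z_i|)\le M\qquad(i=1,2).$$
   Context: A state on a $C^*$-algebra is a positive linear functional of norm one; $S(\mathscr{B})$ is the set of states of $\mathscr{B}$. Hilbert $C^*$-modules are right modules with $\mathscr{A}$-valued inner product $\langle\cdot,\cdot\rangle$, $\mathscr{A}$-linear in the second variable, and $\|x\|=\|\langle x,x\rangle\|^{1/2}$; for $x\in\mathscr{E}$, $|x|=\langle x,x\rangle^{1/2}\in\mathscr{A}$. For a closed subspace $\mathscr{F}\subseteq\mathscr{E}$, $\langle\mathscr{F},\mathscr{F}\rangle$ is the closed linear span of $\{\langle x,y\rangle:x,y\in\mathscr{F}\}$. A closed subspace $\mathscr{F}$ of $\mathscr{E}$ is ternary if $\mathscr{F}\langle\mathscr{F},\mathscr{F}\rangle\subseteq\mathscr{F}$; then $\langle\mathscr{F},\mathscr{F}\rangle$ is a $C^*$-subalgebra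 of $\mathscr{A}$. Ternary subspaces $\mathscr{E}_1,\mathscr{E}_2$ of $\mathscr{E}$ are (Hilbert $C^*$-)module independent if there are constants $m,M>0$ such that for all states $\varphi_i\in S(\langle\mathscr{E}_i,\mathscr{E}_i\rangle)$, $i=1,2$, there is a state $\varphi\in S(\mathscr{A})$ with $m\,\varphi_i(|x|)\le\varphi(|x|)\le M\,\varphi_i(|x|^2)^{1/2}$ for all $x\in\mathscr{E}_i$, $i=1,2$. *)

(* Defs.v *)
From HB Require Import structures.
From mathcomp Require Import all_boot all_order all_algebra.
From mathcomp Require Import complex.
From mathcomp Require Import all_classical all_reals all_analysis.

Set Implicit Arguments.
Unset Strict Implicit.
Unset Printing Implicit Defensive.

Import Order.TTheory GRing.Theory Num.Theory.
Import numFieldNormedType.Exports.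

Local Open Scope classical_set_scope.
Local Open Scope ring_scope.
Local Open Scope complex_scope.

(* Norms of normed spaces over R[i] take their values in R[i]; the order of
   R[i] satisfies u <= v iff v - u is a nonnegative real, so that all the
   inequalities below are inequalities between real numbers. *)

(* Unital C*-algebras.  The product is a field of the mixin, not the product of
   a MathComp ring: a structure inheriting both from the ring and from the
   normed structures would conflict with their existing join [numDomainType]. *)
HB.mixin Record isCStarAlgebra (R : realType) A
    of CompleteNormedModule R[i] A := {
  cone : A ;
  cmul : A -> A -> A ;
  cmulA : forall a b c : A, cmul a (cmul b c) = cmul (cmul a b) c ;
  cmul1l : forall a : A, cmul cone a = a ;
  cmul1r : forall a : A, cmul a cone = a ;
  cmulDl : forall a b c : A, cmul (a + b) c = cmul a c + cmul b c ;
  cmulDr : forall a b c : A, cmul a (b + c) = cmul a b + cmul a c ;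
  cmulZl : forall (k : R[i]) (a b : A), cmul (k *: a) b = k *: cmul a b ;
  cmulZr : forall (k : R[i]) (a b : A), cmul a (k *: b) = k *: cmul a b ;
  star : A -> A ;
  starK : forall a : A, star (star a) = a ;
  starD : forall a b : A, star (a + b) = star a + star b ;
  starZ : forall (k : R[i]) (a : A), star (k *: a) = Num.conj k *: star a ;
  starM : forall a b : A, star (cmul a b) = cmul (star b) (star a) ;
  cstar_normM : forall a b : A, `|cmul a b| <= `|a| * `|b| ;
  cstar_norm : forall a : A, `|cmul (star a) a| = `|a| ^+ 2
}.

#[short(type="cstarAlgType")]
HB.structure Definition CStarAlgebra (R : realType) :=
  {A of CompleteNormedModule R[i] A & isCStarAlgebra R A}.

Notation "a *c b" := (cmul a b) (at level 40, left associativity) : ring_scope.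

Definition cpositive (R : realType) (A : cstarAlgType R) (a : A) : Prop :=
  exists b : A, a = star b *c b.

(* A positive element has exactly one positive square root; the value 0 is
   only used on elements that have none. *)
Definition csqrt (R : realType) (A : cstarAlgType R) (a : A) : A :=
  xget 0 [set b | cpositive b /\ b *c b = a].

(* [act x a] is the right action x a; completeness is that of
   [CompleteNormedModule], whose norm is tied to [inner] by [hilbert_norm]. *)
HB.mixin Record isHilbertModule (R : realType) (A : cstarAlgType R) E
    of CompleteNormedModule R[i] E := {
  act : E -> A -> E ;
  actDl : forall (x y : E) (a : A), act (x + y) a = act x a + act y a ;
  actDr : forall (x : E) (a b : A), act x (a + b) = act x a + act x b ;
  actA : forall (x : E) (a b : A), act x (a *c b) = act (act x a) b ;
  act1 : forall x : E, act x cone = x ;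
  actZl : forall (c : R[i]) (x : E) (a : A), act (c *: x) a = c *: act x a ;
  actZr : forall (c : R[i]) (x : E) (a : A), act x (c *: a) = c *: act x a ;
  inner : E -> E -> A ;
  innerDr : forall x y z : E, inner x (y + z) = inner x y + inner x z ;
  innerZr : forall (c : R[i]) (x y : E), inner x (c *: y) = c *: inner x y ;
  inner_act : forall (x y : E) (a : A), inner x (act y a) = inner x y *c a ;
  inner_star : forall x y : E, star (inner x y) = inner y x ;
  inner_positive : forall x : E, cpositive (inner x x) ;
  inner_definite : forall x : E, inner x x = 0 -> x = 0 ;
  hilbert_norm : forall x : E, `|x| = sqrtC `|inner x x|
}.

#[short(type="hilbertModType")]
HB.structure Definition HilbertModule (R : realType) (A : cstarAlgType R) :=
  {E of CompleteNormedModule R[i] E & isHilbertModule R A E}.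

(* |x| = <x, x>^(1/2) *)
Definition modulus (R : realType) (A : cstarAlgType R) (E : hilbertModType A)
  (x : E) : A := csqrt (inner x x).

Definition linear_span (K : fieldType) (V : lmodType K) (S : set V) : set V :=
  [set v | exists (n : nat) (c : 'I_n -> K) (s : 'I_n -> V),
     (forall i, S (s i)) /\ v = \sum_(i < n) c i *: s i].

(* <F, F> *)
Definition inner_span (R : realType) (A : cstarAlgType R)
    (E : hilbertModType A) (F : set E) : set A :=
  closure (linear_span [set inner x y | x in F & y in F]).

Definition ternary (R : realType) (A : cstarAlgType R) (E : hilbertModType A)
    (F : set E) : Prop :=
  [/\ closed F, submod_closed [in F] &
      forall (x : E) (a : A), F x -> inner_span F a -> F (act x a)].

Definition functional_norm (R : realType) (A : cstarAlgType R) (B : set A)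
    (phi : A -> R[i]) : R :=
  sup [set complex.Re `|phi b| | b in [set b : A | B b /\ `|b| <= 1]].

(* States of a C*-subalgebra B of A.  A functional on B is represented by a
   function on A whose values outside B are irrelevant.  Since sup is 0 on
   unbounded sets, norm one includes boundedness. *)
Definition state_on (R : realType) (A : cstarAlgType R) (B : set A)
    (phi : A -> R[i]) : Prop :=
  [/\ forall (c : R[i]) (a b : A), B a -> B b ->
        phi (c *: a + b) = c * phi a + phi b,
      forall b : A, B b -> 0 <= phi (star b *c b) &
      functional_norm B phi = 1].

Definition module_independent (R : realType) (A : cstarAlgType R)
    (E : hilbertModType A) (E1 E2 : set E) : Prop :=
  exists m M : R, [/\ 0 < m, 0 < M &
    forall phi1 phi2 : A -> R[i],
      state_on (inner_span E1) phi1 -> state_on (inner_span E2) phi2 ->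
      exists phi : A -> R[i], [/\ state_on setT phi,
        forall x : E, E1 x ->
          m%:C * phi1 (modulus x) <= phi (modulus x) /\
          phi (modulus x) <= M%:C * sqrtC (phi1 (modulus x *c modulus x)) &
        forall x : E, E2 x ->
          m%:C * phi2 (modulus x) <= phi (modulus x) /\
          phi (modulus x) <= M%:C * sqrtC (phi2 (modulus x *c modulus x))]].

(* Main.v *)
(* Forward: take states psi_i norming x_i and extend them to phi by module
   independence.  The positive element c = |z_i| - |x_i| is the modulus of
   z_i c, and psi_i (c) = 0 forces psi_i (c^2) = 0, so that phi (c) = 0.

   Backward: given states psi_i, Krein's extension theorem gives a state phi
   with m psi_i <= phi <= M psi_i on the positive part of A_i, unless -1 is a
   positive element plus elements h_i - (m psi_i (a_i) - M psi_i (b_i)) 1 with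
   h_i = a_i - b_i and a_i, b_i positive in A_i.  The latter is excluded by the
   state provided by the hypothesis for the normalization x_i of the positive
   element h_i + (|h_i| + 1) |z_i|: it maximizes h_i, up to the factor
   phi (|z_i|) which lies in [m, M].

   Positive elements are handled without spectral theory: a selfadjoint h is
   positive iff |t - h| <= t for some t, and square roots are limits of the
   iteration y' = (1 - h + y^2) / 2. *)
Require Import Defs.
From HB Require Import structures.
From mathcomp Require Import all_boot all_order all_algebra.
From mathcomp Require Import complex.
From mathcomp Require Import all_classical all_reals all_analysis.
From mathcomp Require Import ring lra.

Set Implicit Arguments.
Unset Strict Implicit.
Unset Printing Implicit Defensive.

Import Order.TTheory GRing.Theory Num.Theory.
Import numFieldNormedType.Exports.

Local Open Scope classical_set_scope.
Local Open Scope ring_scope.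
Local Open Scope complex_scope.

(** * Limits controlled by vanishing real sequences *)

Section Limits.
Variable R : realType.

Lemma gtc0_real (e : R[i]) : 0 < e -> exists2 r : R, 0 < r & e = r%:C.
Proof.
by case: e => a b; rewrite ltcE /= => /andP[/eqP-> a0]; exists a.
Qed.

Lemma gec0_real (e : R[i]) : 0 <= e -> exists2 r : R, 0 <= r & e = r%:C.
Proof.
by case: e => a b; rewrite lecE /= => /andP[/eqP-> a0]; exists a.
Qed.

(** One small value for each [e] is enough: the uses below pick a single index, and in
    [complete_vanishing] the bound at [n] covers all later indices. *)
Definition vanishing (d : nat -> R) :=
  (forall n, 0 <= d n) /\ forall e, 0 < e -> exists n, d n < e.

Lemma vanishing_eq0 (V : normedModType R[i]) (d : nat -> R) (c : R) (v : V) :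
  vanishing d -> (forall n, `|v| <= (c * d n)%:C) -> v = 0.
Proof.
move=> [d0 dv] vd; apply/eqP; rewrite -normr_eq0.
have [r r0 rv] := gec0_real (normr_ge0 v); rewrite rv in vd *.
have {}vd n : r <= c * d n by rewrite -lecR.
have [->//|r_neq0] := eqVneq r 0; have r_gt0 : 0 < r by rewrite lt_def r_neq0.
have C0 : 0 < `|c| + 1 by rewrite ltr_wpDl.
have [n] := dv _ (divr_gt0 r_gt0 C0).
rewrite ltr_pdivlMr// => /lt_geF/negP; case.
apply: le_trans (vd n) _; rewrite mulrC ler_wpM2l//.
by rewrite (le_trans (ler_norm _))// lerDl.
Qed.

Lemma closed_vanishing (V : normedModType R[i]) (B : set V) (d : nat -> R)
    (u : nat -> V) (l : V) : closed B -> vanishing d ->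
  (forall n, B (u n)) -> (forall n, `|l - u n| <= (d n)%:C) -> B l.
Proof.
move=> clB [d0 dv] Bu lu; apply: clB => U /nbhs_ballP[e /= /gtc0_real[r r0 ->] eU].
have [n dn] := dv r r0; exists (u n); split=> //; apply: eU.
by rewrite -ball_normE /=; apply: le_lt_trans (lu n) _; rewrite ltcR.
Qed.

Lemma complete_vanishing (V : completeNormedModType R[i]) (d : nat -> R)
    (u : nat -> V) : vanishing d ->
  (forall n m, (n <= m)%N -> `|u m - u n| <= (d n)%:C) ->
  exists l, forall n, `|l - u n| <= (d n)%:C.
Proof.
move=> [d0 dv] ud.
have /cauchy_cvgP ul : cauchy (u @ \oo).
  apply/cauchyP => _ /gtc0_real[r r0 ->]; have [n dn] := dv r r0.
  exists (u n); exists n => // m /= nm; rewrite -ball_normE /= distrC.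
  by apply: le_lt_trans (ud _ _ nm) _; rewrite ltcR.
exists (lim (u @ \oo)) => n.
have /cvgrPdist_lt uL := ul.
apply/ler_addgt0Pr => e e0; have [N _ /(_ (maxn n N) (leq_maxr _ _))/= le] := uL e e0.
rewrite -(subrK (u (maxn n N)) (lim _)) -addrA addrC.
by apply: le_trans (ler_normD _ _) _; rewrite lerD ?ud ?leq_maxl// ltW.
Qed.

Lemma vanishingM (c : R) (d : nat -> R) :
  0 <= c -> vanishing d -> vanishing (fun n => c * d n).
Proof.
move=> c0 [d0 dv]; split=> [n|e e0]; first exact: mulr_ge0.
have c1 : 0 < c + 1 by rewrite ltr_wpDl.
have [n] := dv _ (divr_gt0 e0 c1); rewrite ltr_pdivlMr// mulrC => dn.
by exists n; apply: le_lt_trans dn; rewrite ler_wpM2r// lerDl.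
Qed.

(** The scalar square root iteration for [h = 0]. It increases to 1 and dominates in norm every
    iteration with [|1 - h| <= 1], so that its distance to 1 is a common rate of convergence. *)
Fixpoint majorant (n : nat) : R :=
  if n is n'.+1 then (1 + majorant n' ^+ 2) / 2 else 0.

Lemma majorant_itv n : 0 <= majorant n <= 1.
Proof.
by elim: n => [|n /andP[r0 r1]] /=; [rewrite lexx ler01 | apply/andP; split; nra].
Qed.

Lemma majorant_mono n : majorant n <= majorant n.+1.
Proof. by have := majorant_itv n => /= /andP[r0 r1]; nra. Qed.

(** The gap [d = 1 - majorant n] passes to [d - d^2 / 2]. If it stayed above [e], it would lose at
    least [e^2 / 2] at each step and end up negative. *)
Lemma majorant_vanishing : vanishing (fun n => 1 - majorant n).
Proof.
split=> [n|e e0]; first by have /andP[] := majorant_itv n; lra.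
apply: contrapT => /forallNP /(_ _) H.
have {}H n : e <= 1 - majorant n by rewrite leNgt; apply/negP/H.
have K n : 1 - majorant n <= 1 - n%:R * (e ^+ 2 / 2).
  elim: n => [|n IH] /=; first by rewrite mul0r.
  have h := H n; rewrite -(natr1 n); set d := 1 - majorant n in IH h *.
  suff: 1 - (1 + majorant n ^+ 2) / 2 = d - d ^+ 2 / 2.
    have : e ^+ 2 <= d ^+ 2 by rewrite ler_pXn2r// nnegrE ltW// (lt_le_trans e0).
    by move=> ? ->; lra.
  by rewrite /d; field.
have e2 : 0 < e ^+ 2 / 2 by rewrite divr_gt0 // exprn_gt0.
have := archi_boundP (ltW (divr_gt0 ltr01 e2)).
set n := Num.bound _; rewrite ltr_pdivrMr// => n1.
by have := K n; have := H n; lra.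
Qed.

End Limits.

(** * Positive elements and square roots in C*-algebras *)

Section CStarTheory.
Variables (R : realType) (A : cstarAlgType R).
Implicit Types (a b c d h k x y : A) (s t : R[i]) (B : set A).

Lemma cmul0l a : 0 *c a = 0.
Proof. by rewrite -(scale0r (0 : A)) cmulZl !scale0r. Qed.

Lemma cmul0r a : a *c 0 = 0.
Proof. by rewrite -(scale0r (0 : A)) cmulZr !scale0r. Qed.

Lemma cmulNl a b : (- a) *c b = - (a *c b).
Proof. by rewrite -scaleN1r cmulZl scaleN1r. Qed.

Lemma cmulNr a b : a *c (- b) = - (a *c b).
Proof. by rewrite -scaleN1r cmulZr scaleN1r. Qed.

Lemma cmulBl a b c : (a - b) *c c = a *c c - b *c c.
Proof. by rewrite cmulDl cmulNl. Qed.

Lemma cmulBr a b c : a *c (b - c) = a *c b - a *c c.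
Proof. by rewrite cmulDr cmulNr. Qed.

Lemma star0 : star 0 = 0 :> A.
Proof. by rewrite -(scale0r (0 : A)) starZ conjC0 !scale0r. Qed.

Lemma starN a : star (- a) = - star a.
Proof. by rewrite -scaleN1r starZ rmorphN1 scaleN1r. Qed.

Lemma starB a b : star (a - b) = star a - star b.
Proof. by rewrite starD starN. Qed.

Lemma starZ_ge0 t a : 0 <= t -> star (t *: a) = t *: star a.
Proof. by move=> t0; rewrite starZ (CrealP _)// ger0_real. Qed.

Lemma star1 : star cone = cone :> A.
Proof. by rewrite -[LHS]cmul1r -{2}[cone]starK -starM cmul1r starK. Qed.

Lemma norm_star a : `|star a| = `|a|.
Proof.
suff le b : `|b| <= `|star b|.
  by apply/eqP; rewrite eq_le le andbT -{2}[a]starK le.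
have [->|b0] := eqVneq b 0; first by rewrite star0.
have b_gt0 : 0 < `|b| by rewrite normr_gt0.
by rewrite -(ler_pM2r b_gt0) -expr2 -cstar_norm cstar_normM.
Qed.

Lemma norm_sqr_sa a : star a = a -> `|a *c a| = `|a| ^+ 2.
Proof. by move=> sa; rewrite -cstar_norm sa. Qed.

Lemma star_cmul_eq0 a : star a *c a = 0 -> a = 0.
Proof.
by move=> aa0; apply/eqP; rewrite -normr_eq0 -sqrf_eq0 -cstar_norm aa0 normr0.
Qed.

Lemma sqr_sa_eq0 a : star a = a -> a *c a = 0 -> a = 0.
Proof. by move=> sa aa0; apply: star_cmul_eq0; rewrite sa. Qed.

Implicit Types e : A.

Lemma norm_idem_le1 e : star e = e -> e *c e = e -> `|e| <= 1.
Proof.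
move=> se ee; have [->|e0] := eqVneq e 0; first by rewrite normr0.
have e_gt0 : 0 < `|e| by rewrite normr_gt0.
by rewrite -(ler_pM2r e_gt0) mul1r -expr2 -norm_sqr_sa// ee.
Qed.

Lemma norm_cone_le1 : `|cone : A| <= 1.
Proof. by apply: norm_idem_le1; rewrite ?star1 ?cmul1l. Qed.

Lemma normZ_cone_le t : 0 <= t -> `|t *: (cone : A)| <= t.
Proof.
by move=> t0; rewrite normrZ ger0_norm// ler_piMr// norm_cone_le1.
Qed.

(** Neither a unit nor stability under [star] is part of this notion, so the commutant of any
    element qualifies. A square root lying in every such [B] that contains [h] therefore both stays
    in a given subalgebra and commutes with whatever commutes with [h]. *)
Definition closed_subalgebra B := [/\ closed B,
  forall t a b, B a -> B b -> B (t *: a + b), B 0 &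
  forall a b, B a -> B b -> B (a *c b)].

Section ClosedSubalgebra.
Variables (B : set A) (sB : closed_subalgebra B).

Lemma csubD a b : B a -> B b -> B (a + b).
Proof. by case: sB => _ BD _ _ Ba Bb; rewrite -(scale1r a); apply: BD. Qed.

Lemma csubZ t a : B a -> B (t *: a).
Proof. by case: sB => _ BD B0 _ Ba; rewrite -(addr0 (_ *: _)); apply: BD. Qed.

Lemma csubN a : B a -> B (- a).
Proof. by rewrite -scaleN1r; apply: csubZ. Qed.

Lemma csubB a b : B a -> B b -> B (a - b).
Proof. by move=> Ba /csubN; apply: csubD. Qed.

Lemma csubM a b : B a -> B b -> B (a *c b).
Proof. by case: sB => _ _ _; apply. Qed.

End ClosedSubalgebra.

Lemma lipschitz_continuous (V : normedModType R[i]) (f : V -> A) (K : R[i]) :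
  0 <= K -> (forall u v, `|f u - f v| <= K * `|u - v|) -> continuous f.
Proof.
move=> K0 fK x; apply/cvgrPdist_lt => e e0.
have K1 : 0 < K + 1 by rewrite ltr_wpDl.
near=> y; apply: le_lt_trans (fK _ _) _.
have xy : `|x - y| < e / (K + 1).
  by near: y; apply: cvgr_dist_lt => //; rewrite divr_gt0.
apply: le_lt_trans (_ : (K + 1) * `|x - y| < e).
  by rewrite ler_wpM2r// lerDl.
by rewrite mulrC -ltr_pdivlMr.
Unshelve. all: by end_near. Qed.

Lemma cmull_continuous a : continuous (fun x => a *c x).
Proof.
apply: (@lipschitz_continuous _ _ `|a|) => // x y.
by rewrite -cmulBr cstar_normM.
Qed.

Lemma cmulr_continuous a : continuous (fun x => x *c a).
Proof.
apply: (@lipschitz_continuous _ _ `|a|) => // x y.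
by rewrite -cmulBl mulrC cstar_normM.
Qed.

Lemma star_continuous : continuous (@star R A).
Proof.
apply: (@lipschitz_continuous _ _ 1) => // x y.
by rewrite -starB norm_star mul1r.
Qed.

Definition commutant c : set A := [set x | x *c c = c *c x].

Lemma closed_subalgebra_commutant c : closed_subalgebra (commutant c).
Proof.
split=> [|t a b /= ac bc||a b ac bc]; rewrite /commutant /=.
- have -> : [set x | x *c c = c *c x] = (fun x => x *c c - c *c x) @^-1` [set 0].
    apply/seteqP; split=> x /=; first by move=> ->; rewrite subrr.
    by move=> /eqP; rewrite subr_eq0 => /eqP.
  have cl0 : closed [set (0 : A)].
    exact: accessible_closed_set1 (hausdorff_accessible (@norm_hausdorff _ _)) _.
  apply: preimage_closed cl0 => x _.
  apply: (@continuousB _ _ _ (cmul^~ c) (cmul c)); first exact: cmulr_continuous.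
  exact: cmull_continuous.
- by rewrite cmulDl cmulDr cmulZl cmulZr ac bc.
- by rewrite cmul0l cmul0r.
- by rewrite -cmulA bc cmulA ac cmulA.
Qed.

(** * Square roots by iteration *)

Section SquareRoot.
Variables (h : A) (sa_h : star h = h) (norm_h : `|cone - h| <= 1).

(** Substituting [k = 1 - y] in [k^2 = h] gives the fixed point equation [y = (1 - h + y^2) / 2],
    iterated here from 0. *)
Fixpoint sqrt_iter (n : nat) : A :=
  if n is n'.+1 then
    (2^-1 : R)%:C *: (cone - h + sqrt_iter n' *c sqrt_iter n')
  else 0.

Local Notation y := sqrt_iter.
Local Notation r := (majorant R).

Lemma norm_sqrt_iter n : `|y n| <= (r n)%:C.
Proof.
elim: n => [|n IH]; first by rewrite /= normr0.
rewrite [y _]/= [r _]/= normrZ ger0_norm ?ler0c ?invr_ge0//.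
rewrite mulrC rmorphM ler_wpM2r ?ler0c ?invr_ge0//.
apply: le_trans (ler_normD _ _) _; rewrite rmorphD lerD//.
apply: le_trans (cstar_normM _ _) _.
by rewrite expr2 rmorphM ler_pM.
Qed.

(** The difference of squares [u^2 - v^2] is written [u (u - v) + (u - v) v], which needs no
    commutation. The same factorization of the increments of [majorant] makes the two sides match
    term by term. *)
Lemma sqrt_iter_step n : `|y n.+1 - y n| <= (r n.+1 - r n)%:C.
Proof.
elim: n => [|n IH].
  by have := norm_sqrt_iter 1; rewrite [y 0%N]/= [r 0%N]/= !subr0.
have yS m : y m.+1 = (2^-1 : R)%:C *: (cone - h + y m *c y m) by [].
rewrite [y n.+2]yS [X in _ - X]yS -scalerBr opprD addrACA subrr add0r.
rewrite normrZ ger0_norm ?ler0c ?invr_ge0//.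
have -> : y n.+1 *c y n.+1 - y n *c y n =
    y n.+1 *c (y n.+1 - y n) + (y n.+1 - y n) *c y n.
  by rewrite cmulBr cmulBl addrA subrK.
have -> : r n.+2 - r n.+1 = 2^-1 * (r n.+1 * (r n.+1 - r n) + (r n.+1 - r n) * r n).
  have rS m : r m.+1 = (1 + r m ^+ 2) / 2 by [].
  by rewrite [r n.+2]rS [X in _ - X]rS; field.
rewrite rmorphM ler_wpM2l ?ler0c ?invr_ge0//.
rewrite rmorphD; apply: le_trans (ler_normD _ _) _.
rewrite (rmorphM _ (r n.+1)) (rmorphM _ _ (r n)).
by apply: lerD; apply: le_trans (cstar_normM _ _) _; apply: ler_pM => //;
  apply: norm_sqrt_iter.
Qed.

Lemma sqrt_iter_cauchy n m : (n <= m)%N -> `|y m - y n| <= (1 - r n)%:C.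
Proof.
move=> nm; apply: le_trans (_ : (r m - r n)%:C <= _); last first.
  by rewrite lecR; have /andP[_] := majorant_itv R m; lra.
elim: m nm => [|m IH]; first by rewrite leqn0 => /eqP->; rewrite !subrr normr0.
rewrite leq_eqVlt => /orP[/eqP<-|]; first by rewrite !subrr normr0.
rewrite ltnS => /IH nm.
rewrite -(subrK (y m) (y m.+1)) -addrA; apply: le_trans (ler_normD _ _) _.
have -> : r m.+1 - r n = (r m.+1 - r m) + (r m - r n) by ring.
by rewrite rmorphD lerD// sqrt_iter_step.
Qed.

Lemma star_sqrt_iter n : star (y n) = y n.
Proof.
elim: n => [|n IH] /=; first exact: star0.
by rewrite starZ_ge0 ?ler0c ?invr_ge0// starD starB starM IH star1 sa_h.
Qed.

(** [B] may lack [cone], so the iterates themselves can leave it. Their scalar part is [r n], and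
    removing it leaves elements of [B] that tend to [1 - y = k]. *)
Lemma sqrt_iter_csub B n :
  closed_subalgebra B -> B h -> B ((r n)%:C *: cone - y n).
Proof.
move=> sB Bh; elim: n => [|n IH]; first by rewrite /= scale0r subrr; case: sB.
set u := _ - y n in IH; set q := (r n)%:C in u IH.
have Buy : B (u *c y n).
  have -> : y n = q *: cone - u by rewrite /u subKr.
  rewrite cmulBr cmulZr cmul1r.
  by apply: (csubB sB); [exact: (csubZ sB) | exact: (csubM sB)].
have -> : (r n.+1)%:C *: cone - y n.+1 =
    (2^-1 : R)%:C *: (h + (u *c y n + q *: u)).
  rewrite [y n.+1]/= [r n.+1]/= mulrC rmorphM -scalerA -scalerBr.
  rewrite rmorphD rmorph1 scalerDl scale1r opprD addrACA opprB [cone + _]addrC.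
  congr (_ *: (_ + _)); first by rewrite subrK.
  rewrite /u cmulBl cmulZl cmul1l scalerBr scalerA -rmorphM -expr2.
  by rewrite [RHS]addrC addrA subrK.
by apply: (csubZ sB); do 2?apply: (csubD sB) => //; exact: (csubZ sB).
Qed.

Lemma sqrt_contraction : exists k, [/\ star k = k, `|cone - k| <= 1,
  k *c k = h & forall B, closed_subalgebra B -> B h -> B k].
Proof.
have dv := majorant_vanishing R.
have [l ly] := complete_vanishing dv sqrt_iter_cauchy.
have l1 : `|l| <= 1.
  by have := ly 0%N; rewrite /= !subr0.
have y1 n : `|y n| <= 1.
  by apply: le_trans (norm_sqrt_iter n) _; rewrite lecR; case/andP: (majorant_itv R n).
have sa_l : star l = l.
  apply/eqP; rewrite -subr_eq0; apply/eqP; apply: (vanishing_eq0 (c := 2) dv) => n.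
  rewrite -(subrK (y n) (star l)) -addrA; apply: le_trans (ler_normD _ _) _.
  rewrite mulr_natl mulr2n rmorphD lerD//; last by rewrite distrC.
  by rewrite -{1}(star_sqrt_iter n) -starB norm_star.
have le_l : l + l = cone - h + l *c l.
  (* The defect equals twice [l - y n.+1] minus [l^2 - (y n)^2]. Factoring the difference of squares
     gives four terms, each at most [1 - r n] because [l] and [y n] have norm at most 1; hence the
     constant 4. *)
  apply/eqP; rewrite -subr_eq0; apply/eqP; apply: (vanishing_eq0 (c := 4) dv) => n.
  have -> : l + l - (cone - h + l *c l) =
      ((l - y n.+1) + (l - y n.+1)) - (l *c (l - y n) + (l - y n) *c y n).
    have y2 : y n.+1 + y n.+1 = cone - h + y n *c y n.
      have half : 2^-1 + 2^-1 = 1 :> R by lra.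
      by rewrite [y n.+1]/= -scalerDl -rmorphD half scale1r.
    rewrite addrACA -opprD y2 cmulBr cmulBl addrA subrK.
    rewrite -[RHS]addrA -opprD -[_ + _ + (_ - _)]addrA.
    by rewrite [_ *c _ + (_ - _)]addrC subrK.
  apply: le_trans (ler_normB _ _) _.
  have yS : `|l - y n.+1| <= (1 - r n)%:C.
    by apply: le_trans (ly _) _; rewrite lecR lerB// majorant_mono.
  have yn := ly n.
  have -> : 4 * (1 - r n) = ((1 - r n) + (1 - r n)) + ((1 - r n) + (1 - r n)).
    by ring.
  have [q qE] : exists q : R, q = 1 - r n by exists (1 - r n).
  rewrite -qE in yn yS *.
  rewrite !rmorphD; apply: lerD.
    by apply: le_trans (ler_normD _ _) _; apply: lerD.
  apply: le_trans (ler_normD _ _) _; apply: lerD; apply: le_trans (cstar_normM _ _) _.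
    by rewrite -[leRHS]mul1r ler_pM.
  by rewrite -[leRHS]mulr1 ler_pM.
exists (cone - l); split.
- by rewrite starB star1 sa_l.
- by rewrite subKr.
- rewrite cmulBl !cmulBr !cmul1l cmul1r opprB addrCA -addrA -opprD.
  by rewrite le_l opprD [cone + (_ - _)]addrA subKr addrC subrK.
- move=> B sB Bh.
  have [clB _ _ _] := sB.
  apply: (closed_vanishing (u := fun n => (r n)%:C *: cone - y n)
      clB (vanishingM (ler0n R 2) dv)) => n; first exact: sqrt_iter_csub.
  have -> : cone - l - ((r n)%:C *: cone - y n) =
      (1 - r n)%:C *: cone - (l - y n).
    by rewrite rmorphB scalerBl scale1r !opprB addrACA [- l - _]addrC addrACA.
  apply: le_trans (ler_normB _ _) _.
  rewrite [2 * _]mulr_natl mulr2n (rmorphD _ (1 - r n)); apply: lerD => //.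
  by apply: normZ_cone_le; rewrite ler0c; case: dv.
Qed.

End SquareRoot.

(** * Positivity through the norm *)

(** In this form, stability under sums is the triangle inequality, whereas it is not evident for
    [cpositive]. The two notions are shown to agree in [cpositiveP]. *)
Definition psd h := star h = h /\ exists t, `|t *: cone - h| <= t.

Lemma psd_sa h : psd h -> star h = h. Proof. by case. Qed.

Lemma psdD a b : psd a -> psd b -> psd (a + b).
Proof.
move=> [sa [s sP]] [sb [t tP]]; split; first by rewrite starD sa sb.
exists (s + t); rewrite scalerDl opprD addrACA.
exact: le_trans (ler_normD _ _) (lerD sP tP).
Qed.

Lemma psdZ t a : 0 <= t -> psd a -> psd (t *: a).
Proof.
move=> t0 [sa [s sP]]; split; first by rewrite starZ_ge0 ?sa.
by exists (t * s); rewrite -scalerA -scalerBr normrZ ger0_norm// ler_wpM2l.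
Qed.

Lemma psd_sqrt h : psd h -> exists k, [/\ psd k, k *c k = h &
  forall B, closed_subalgebra B -> B h -> B k].
Proof.
move=> [sa_h [t ht]]; have t0 : 0 <= t := le_trans (normr_ge0 _) ht.
have [tz|t_neq0] := eqVneq t 0.
  move: ht; rewrite tz scale0r sub0r normrN normr_le0 => /eqP->.
  exists 0; split; rewrite ?cmul0l//; split; rewrite ?star0//.
  by exists 0; rewrite scale0r subr0 normr0.
have t_gt0 : 0 < t by rewrite lt_def t_neq0.
have ti0 : 0 <= t^-1 by rewrite invr_ge0.
have sa_th : star (t^-1 *: h) = t^-1 *: h by rewrite starZ_ge0// sa_h.
have norm_th : `|cone - t^-1 *: h| <= 1.
  rewrite -(scale1r cone) -(mulVf t_neq0) -scalerA -scalerBr normrZ ger0_norm//.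
  exact: ler_wpM2l.
have [k [sa_k norm_k kk kB]] := sqrt_contraction sa_th norm_th.
have st0 : 0 <= sqrtC t by rewrite sqrtC_ge0.
exists (sqrtC t *: k); split.
- by apply: psdZ => //; split=> //; exists 1; rewrite scale1r.
- by rewrite cmulZl cmulZr scalerA -expr2 sqrtCK kk scalerA divff// scale1r.
- by move=> B sB Bh; apply: (csubZ sB); apply: kB => //; apply: (csubZ sB).
Qed.

(** For commuting selfadjoint [k] and [l], the element [u = k + i l] satisfies [u^* u = k^2 + l^2].
    Since [2 i l = u - u^*], the norm of [l] is at most that of [u]. *)
Lemma norm_sqr_le_sum k l : star k = k -> star l = l -> k *c l = l *c k ->
  `|l| ^+ 2 <= `|k *c k + l *c l|.
Proof.
move=> sk sl kl; pose u := k + 'i *: l.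
have su : star u = k - 'i *: l.
  by rewrite starD starZ sk sl conjCi scaleNr.
have <- : star u *c u = k *c k + l *c l.
  rewrite su /u cmulBl !cmulDr !cmulZl !cmulZr scalerA -expr2 sqrCi scaleN1r kl.
  by rewrite addrKA opprK.
rewrite cstar_norm ler_pXn2r ?nnegrE//.
have := ler_normB u (star u); rewrite norm_star.
have -> : u - star u = 2%:R *: ('i *: l).
  by rewrite su /u opprB [_ + ('i *: l - k)]addrC addrA subrK scaler_nat mulr2n.
by rewrite !normrZ normCi mul1r normr_nat -mulr2n -[leRHS]mulr_natl ler_pM2l.
Qed.

(** After scaling to [s = 1], the element [1 - k^2] has a square root [l] commuting with [k]. Then
    [norm_sqr_le_sum] bounds [|l|^2 = |1 - k^2|] by [|k^2 + l^2| = |1|]. *)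
Lemma norm_sub_sqr k s : star k = k -> `|k *c k| <= s ->
  `|s *: cone - k *c k| <= s.
Proof.
move=> sk ks; have s0 : 0 <= s := le_trans (normr_ge0 _) ks.
have [sz|s_neq0] := eqVneq s 0.
  by rewrite sz scale0r sub0r normrN -sz.
have s_gt0 : 0 < s by rewrite lt_def s_neq0.
pose k' := (sqrtC s)^-1 *: k; have c0 : 0 <= (sqrtC s)^-1.
  by rewrite invr_ge0 sqrtC_ge0.
have sk' : star k' = k' by rewrite starZ_ge0 ?sk.
have kk' : k' *c k' = s^-1 *: (k *c k).
  by rewrite cmulZl cmulZr scalerA -expr2 exprVn sqrtCK.
have -> : s *: cone - k *c k = s *: (cone - k' *c k').
  by rewrite kk' scalerBr scalerA divff// scale1r.
rewrite normrZ ger0_norm// ler_piMr//.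
have sa : star (cone - k' *c k') = cone - k' *c k' by rewrite starB star1 starM sk'.
have nk : `|cone - (cone - k' *c k')| <= 1.
  by rewrite subKr kk' normrZ ger0_norm ?invr_ge0// mulrC ler_pdivrMr// mul1r.
have [l [sl _ ll lB]] := sqrt_contraction sa nk.
have kl : k' *c l = l *c k'.
  apply/esym/(lB _ (closed_subalgebra_commutant k')).
  by rewrite /commutant /= cmulBl cmulBr cmul1l cmul1r cmulA.
have := norm_sqr_le_sum sk' sl kl.
rewrite -(norm_sqr_sa sl) ll [k' *c k' + _]addrC subrK => /le_trans; apply.
exact: norm_cone_le1.
Qed.

Lemma psd_sqr k : star k = k -> psd (k *c k).
Proof.
by move=> sk; split; [rewrite starM sk|exists (`|k *c k|); apply: norm_sub_sqr].
Qed.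

Lemma psd_cone : psd cone.
Proof. by rewrite -[cone]cmul1l; apply: psd_sqr; rewrite star1. Qed.

Lemma psd_subr h s : star h = h -> `|h| <= s -> psd (s *: cone - h).
Proof.
move=> sh hs; have s0 : 0 <= s := le_trans (normr_ge0 _) hs.
split; first by rewrite starB starZ_ge0 // star1 sh.
by exists s; rewrite subKr.
Qed.

(** The square roots of [a] and [b] commute, as each lies in every commutant containing its square;
    [norm_sqr_le_sum] applies to them. *)
Lemma norm_psd_add a b : psd a -> psd b -> a *c b = b *c a -> `|a| <= `|a + b|.
Proof.
move=> /psd_sqrt[k [[sk _] <- kB]] /psd_sqrt[l [[sl _] <- lB]] ab.
have al : k *c k *c l = l *c (k *c k).
  by apply/esym/(lB _ (closed_subalgebra_commutant (k *c k))).
have kl : l *c k = k *c l.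
  by apply/esym/(kB _ (closed_subalgebra_commutant l)).
by rewrite addrC norm_sqr_sa// norm_sqr_le_sum.
Qed.

Lemma psd_anti h : psd h -> psd (- h) -> h = 0.
Proof.
move=> ph pnh; have hc : h *c (- h) = - h *c h by rewrite cmulNl cmulNr.
have := norm_psd_add ph pnh hc; rewrite subrr normr0 normr_le0.
by move/eqP.
Qed.

Lemma sqrD_subsqrB a b :
  (a + b) *c (a + b) - (a - b) *c (a - b) = 2%:R *: (a *c b + b *c a).
Proof.
have -> : (a + b) *c (a + b) = a *c a + b *c b + (a *c b + b *c a).
  by rewrite cmulDl !cmulDr [b *c a + _]addrC addrACA.
have -> : (a - b) *c (a - b) = a *c a + b *c b - (a *c b + b *c a).
  by rewrite cmulBl !cmulBr opprB addrACA -opprD.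
by rewrite opprB addrC subrKA scaler_nat mulr2n.
Qed.

(* With d the square root of - c^* c, the element x = c d satisfies
   x^* x = - d^4 and x x^* = - (c c^* )^2, whereas x^* x + x x^* is twice a sum
   of two squares of selfadjoint elements. *)
Lemma star_cmul_npsd c : psd (- (star c *c c)) -> c = 0.
Proof.
move=> /psd_sqrt[d [[sd _] dd _]]; pose x := c *c d.
have xx : star x *c x = - (d *c d *c (d *c d)).
  rewrite /x starM sd -cmulA [star c *c _]cmulA -[star c *c c]opprK -dd.
  by rewrite cmulNl cmulNr !cmulA.
have xx' : x *c star x = - (c *c star c *c (c *c star c)).
  rewrite /x starM sd -cmulA [d *c (d *c _)]cmulA dd.
  by rewrite cmulNl cmulNr !cmulA.
pose u := x + star x; pose v := 'i *: (x - star x).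
have su : star u = u by rewrite starD starK addrC.
have sv : star v = v by rewrite starZ conjCi starB starK scaleNr -scalerN opprB.
have uv : u *c u + v *c v = 2%:R *: (star x *c x + x *c star x).
  rewrite /u /v cmulZl cmulZr scalerA -expr2 sqrCi scaleN1r.
  by rewrite sqrD_subsqrB [x *c _ + _]addrC.
have sum_psd : psd (star x *c x + x *c star x).
  rewrite -[_ + _]scale1r -[1](@mulVf _ 2%:R) ?pnatr_eq0// -scalerA -uv.
  by apply: psdZ; rewrite ?invr_ge0 ?ler0n//; apply: psdD; apply: psd_sqr.
have xx_npsd : psd (- (star x *c x)).
  by rewrite xx opprK; apply: psd_sqr; rewrite starM sd.
have xx_psd : psd (star x *c x).
  rewrite -[star x *c x](addrK (x *c star x)); apply: psdD => //.
  by rewrite xx' opprK; apply: psd_sqr; rewrite starM starK.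
have xx0 : star x *c x = 0 by apply: psd_anti.
have dd0 : d *c d = 0.
  apply: sqr_sa_eq0; first by rewrite starM sd.
  by rewrite -[LHS]opprK -xx xx0 oppr0.
by apply: star_cmul_eq0; rewrite -[LHS]opprK -dd dd0 oppr0.
Qed.

(* If [q] is [k - h] with [k] the square root of [h^2], then [b q] satisfies
   [(b q)^* (b q) = q h q = - q k q], hence vanishes, and [q = 0] follows. *)
Lemma psd_star_cmul b : psd (star b *c b).
Proof.
set h := star b *c b; have sh : star h = h by rewrite starM starK.
have [k [pk kk kB]] := psd_sqrt (psd_sqr sh); have sk := psd_sa pk.
have kh : k *c h = h *c k.
  by apply: (kB _ (closed_subalgebra_commutant h)); rewrite /commutant /= cmulA.
pose q := k - h; have sq : star q = q by rewrite starB sk sh.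
have qh : q *c h = - (q *c k).
  by rewrite /q !cmulBl kk opprB -kh.
have [l [[sl _] ll lB]] := psd_sqrt pk.
have lq : l *c q = q *c l.
  apply: (lB _ (closed_subalgebra_commutant q)).
  by rewrite /commutant /= cmulBr cmulBl kh.
have qkq : q *c k *c q = l *c q *c (l *c q).
  by rewrite -ll {1}lq !cmulA.
have slq : star (l *c q) = l *c q by rewrite starM sl sq lq.
have c0 : b *c q = 0.
  apply: star_cmul_npsd; rewrite starM sq.
  have -> : q *c star b *c (b *c q) = q *c h *c q by rewrite !cmulA.
  by rewrite qh cmulNl opprK qkq; apply: psd_sqr.
(* With [l] the square root of [k], [(l q)^2 = q k q = - q h q = 0]. So [k q] and [h q] both vanish,
   and so does [q^2 = (k - h) q]. *)
have lq0 : l *c q = 0.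
  apply: sqr_sa_eq0 => //; rewrite -qkq -[LHS]opprK -cmulNl -qh /h.
  by rewrite -!cmulA c0 !cmul0r oppr0.
have kq0 : k *c q = 0 by rewrite -ll -cmulA lq0 cmul0r.
have hq0 : h *c q = 0 by rewrite /h -cmulA c0 cmul0r.
have q0 : q = 0 by apply: sqr_sa_eq0 => //; rewrite {1}/q cmulBl kq0 hq0 subr0.
by move/eqP: q0; rewrite subr_eq0 => /eqP <-.
Qed.

(** * The cone of positive elements and uniqueness of square roots *)

Lemma cpositiveP a : cpositive a <-> psd a.
Proof.
split=> [[b ->]|/psd_sqrt[k [pk <- _]]]; first exact: psd_star_cmul.
by exists k; rewrite (psd_sa pk).
Qed.

Lemma cpositive_sa a : cpositive a -> star a = a.
Proof. by move/cpositiveP/psd_sa. Qed.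

Lemma cpositiveD a b : cpositive a -> cpositive b -> cpositive (a + b).
Proof. by move=> /cpositiveP pa /cpositiveP pb; apply/cpositiveP/psdD. Qed.

Lemma cpositiveZ t a : 0 <= t -> cpositive a -> cpositive (t *: a).
Proof. by move=> t0 /cpositiveP pa; apply/cpositiveP/psdZ. Qed.

Lemma cpositive0 : cpositive (0 : A).
Proof. by exists 0; rewrite cmul0r. Qed.

Lemma cpositive_cone : cpositive (cone : A).
Proof. exact/cpositiveP/psd_cone. Qed.

Lemma cpositive_anti a : cpositive a -> cpositive (- a) -> a = 0.
Proof. by move=> /cpositiveP pa /cpositiveP; apply: psd_anti. Qed.

Lemma cpositive_subr h s : star h = h -> `|h| <= s -> cpositive (s *: cone - h).
Proof. by move=> sh hs; apply/cpositiveP/psd_subr. Qed.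

Lemma cpositive_sqrt a : cpositive a -> exists k, [/\ cpositive k, k *c k = a &
  forall B, closed_subalgebra B -> B a -> B k].
Proof.
by move=> /cpositiveP/psd_sqrt[k [pk ? ?]]; exists k; split=> //; apply/cpositiveP.
Qed.

Lemma cpositive_conj a x : cpositive a -> cpositive (star x *c a *c x).
Proof.
move=> /cpositive_sqrt[k [/cpositive_sa sk <- _]].
by exists (k *c x); rewrite starM sk !cmulA.
Qed.

Lemma norm_cpositive_le a s : 0 <= s ->
  cpositive a -> cpositive (s *: cone - a) -> `|a| <= s.
Proof.
move=> s0 /cpositiveP pa /cpositiveP pb.
have ab : a *c (s *: cone - a) = (s *: cone - a) *c a.
  by rewrite cmulBl cmulBr cmulZl cmulZr cmul1l cmul1r.
have := norm_psd_add pa pb ab; rewrite addrC subrK => /le_trans; apply.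
exact: normZ_cone_le.
Qed.

(* With [w = a - k], the elements [w a w] and [w k w] are positive and sum to
   [w (a + k) w = 0], so [w^3 = 0]. *)
Lemma cpositive_sqr_inj a b : cpositive a -> cpositive b ->
  a *c a = b *c b -> a = b.
Proof.
have suff_commute k c : cpositive k -> cpositive c -> c *c k = k *c c ->
    c *c c = k *c k -> c = k.
  move=> pk pc ck cckk; pose w := c - k.
  have sw : star w = w by rewrite starB !cpositive_sa.
  have wcw := cpositive_conj w pc; have wkw := cpositive_conj w pk.
  rewrite sw in wcw wkw.
  have w0 : w *c c + w *c k = 0.
    by rewrite /w !cmulBl cckk ck addrA subrK subrr.
  have wcw0 : w *c c *c w = 0.
    apply: cpositive_anti => //; suff -> : - (w *c c *c w) = w *c k *c w by [].
    by apply/eqP; rewrite eq_sym -addr_eq0 addrC -cmulDl w0 cmul0l.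
  have wkw0 : w *c k *c w = 0.
    by rewrite -[LHS]add0r -wcw0 -cmulDl w0 cmul0l.
  have www : w *c w *c w = 0.
    by rewrite {2}/w cmulBr cmulBl wcw0 wkw0 subrr.
  have ww : w *c w = 0.
    by apply: sqr_sa_eq0; rewrite ?starM ?sw// cmulA www cmul0l.
  by move/eqP: (sqr_sa_eq0 sw ww); rewrite subr_eq0 => /eqP.
move=> pa pb ab.
(* [a] and [b] are not known to commute. Both are compared with this [k], which commutes with each
   of them because it lies in every commutant containing [a^2 = b^2]. *)
have [k [pk kk kB]] : exists k, [/\ cpositive k, k *c k = a *c a &
    forall B, closed_subalgebra B -> B (a *c a) -> B k].
  by apply: cpositive_sqrt; exists a; rewrite cpositive_sa.
have comm c : c *c c = a *c a -> c *c k = k *c c.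
  move=> cc; apply/esym/(kB _ (closed_subalgebra_commutant c)).
  by rewrite /commutant /= -cc cmulA.
rewrite (suff_commute _ _ pk pa (comm _ erefl) (esym kk)).
by rewrite (suff_commute _ _ pk pb (comm _ (esym ab)) (etrans (esym ab) (esym kk))).
Qed.

Lemma csqrtP a : cpositive a -> cpositive (csqrt a) /\ csqrt a *c csqrt a = a.
Proof.
move=> /cpositive_sqrt[k [pk kk _]].
by apply: (@xgetPex _ 0 [set b | cpositive b /\ b *c b = a]); exists k.
Qed.

Lemma csqrt_unique a b : cpositive b -> b *c b = a -> csqrt a = b.
Proof.
move=> pb bb; have pa : cpositive a by exists b; rewrite cpositive_sa.
have [ps ss] := csqrtP pa; apply: cpositive_sqr_inj => //.
by rewrite ss bb.
Qed.

Lemma csqrt_csub a B : closed_subalgebra B -> cpositive a -> B a -> B (csqrt a).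
Proof.
move=> sB /cpositive_sqrt[k [pk kk kB]] Ba.
by rewrite (csqrt_unique pk kk); apply: kB.
Qed.

End CStarTheory.

(** * Krein's extension theorem *)

Section Krein.
Variables (R : realType) (V : lmodType R[i]).
Implicit Types (C D : set V) (x y : V).

Definition convex_cone C := [/\ C 0, forall x y, C x -> C y -> C (x + y) &
  forall (t : R[i]) x, 0 <= t -> C x -> C (t *: x)].

(** Zorn's lemma gives a maximal cone [D] avoiding [- e]. If it contained neither [x] nor [- x],
    adjoining either one would produce [- e], say [- e = d + t x = d' - s x]; the combination with
    weights [s] and [t] eliminates [x] and puts [- e] in [D]. *)
Lemma maximal_cone C (e : V) : convex_cone C -> ~ C (- e) ->
  exists D, [/\ convex_cone D, C `<=` D, ~ D (- e) &
    forall x, D x \/ D (- x)].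
Proof.
move=> coneC Ce; have [C0 CD CZ] := coneC.
(* Adjoining [C] inside the property takes care of the empty chain, whose union is empty. *)
pose P X := convex_cone (X `|` C) /\ ~ (X `|` C) (- e).
have [F FP totF|X [[coneX Xe] Xmax]] := @Zorn_bigcup V P.
  have FCe : ~ (\bigcup_(X in F) X `|` C) (- e).
    by case=> // -[X FX Xe]; have [_] := FP _ FX; apply; left.
  split=> //; split; first by right.
  - have cup X Y x y : F X -> Y `<=` X -> (X `|` C) x -> (Y `|` C) y ->
        (\bigcup_(X in F) X `|` C) (x + y).
      move=> FX YX Xx Yy; have [[_ XD _] _] := FP _ FX.
      have : (X `|` C) (x + y) by apply: XD => //; case: Yy => [/YX|]; [left|right].
      by case; [left; exists X|right].
    move=> x y [[X FX Xx]|Cx] [[Y FY Yy]|Cy].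
    + have [YX|XY] := totF _ _ FY FX; first by apply: (cup X Y); rewrite //; left.
      by rewrite addrC; apply: (cup Y X); rewrite //; left.
    + by apply: (cup X X) => //; [left|right].
    + by apply: (cup Y Y) => //; [right|left].
    + by right; apply: CD.
  - move=> t x t0 [[X FX Xx]|Cx]; last by right; apply: CZ.
    have [[_ _ XZ] _] := FP _ FX.
    by case: (XZ t x t0 (or_introl Xx)); [left; exists X|right].
exists (X `|` C); split=> // x; have [D0 DD DZ] := coneX.
set D := X `|` C in coneX Xe D0 DD DZ *.
have half y : ~ D y -> exists t d, [/\ 0 <= t, D d & - e = d + t *: y].
  move=> Dy; apply: contrapT => NDe.
  pose D' := [set z | exists t d, [/\ 0 <= t, D d & z = d + t *: y]].
  have DD' : D `<=` D'.
    by move=> d Dd; exists 0, d; rewrite scale0r addr0.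
  have D'E : D' `|` C = D'.
    by apply/seteqP; split=> z; [case=> // Cz; apply: DD'; right|left].
  apply: (Xmax D').
    split; first by move=> z Xz; apply: DD'; left.
    move=> D'X; apply: Dy; left; apply: D'X.
    by exists 1, 0; rewrite scale1r add0r.
  split; rewrite D'E//; split; first exact: DD'.
  - move=> _ _ [t [d [t0 Dd ->]]] [s [d' [s0 Dd' ->]]].
    exists (t + s), (d + d'); rewrite addr_ge0// scalerDl addrACA.
    by split=> //; apply: DD.
  - move=> r _ r0 [t [d [t0 Dd ->]]]; exists (r * t), (r *: d).
    by rewrite mulr_ge0// scalerDr scalerA; split=> //; apply: DZ.
apply: contrapT => /not_orP[/half[t [d [t0 Dd te]]] /half[s [d' [s0 Dd' se]]]].
have [tz|t_neq0] := eqVneq t 0.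
  by apply: Xe; rewrite te tz scale0r addr0.
have st : 0 < s + t by rewrite ltr_wpDl// lt_def t_neq0.
apply: Xe; have -> : - e = (s + t)^-1 *: (s *: d + t *: d').
  have -> : s *: d + t *: d' = (s + t) *: (- e).
    rewrite scalerDl {1}te se !scalerDr !scalerN !scalerA [t * s]mulrC.
    by rewrite addrACA subrr addr0.
  by rewrite scalerA mulVf ?scale1r// gt_eqF.
by apply: (DZ); [rewrite invr_ge0 ltW|apply: DD; apply: DZ].
Qed.

(** A maximal cone [D] is a half-space up to its boundary, and [f x] is the cut where [x - t e]
    leaves [D]. [f_spec] and [f_unique] characterize this cut with a margin [ep], so it does not
    matter which boundary points belong to [D]; linearity follows by adding and scaling margins. *)
Lemma krein_functional C (e : V) : convex_cone C ->
  (forall x, exists2 t : R[i], 0 <= t & C (t *: e - x)) -> ~ C (- e) ->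
  exists f : V -> R, [/\ forall x y, f (x + y) = f x + f y,
    forall (t : R) x, f (t%:C *: x) = t * f x,
    forall x, C x -> 0 <= f x & f e = 1].
Proof.
move=> coneC unit_e Ce.
have [D [[D0 DD DZ] CD De totD]] := maximal_cone coneC Ce.
have unitD x : exists t : R, D (t%:C *: e - x).
  by have [_ /gec0_real[t t0 ->] Ct] := unit_e x; exists t; apply: CD.
have De0 : D e.
  have [_ /gec0_real[t t0 ->] /CD] := unit_e (- e).
  rewrite opprK -[X in _ + X]scale1r -scalerDl.
  have t1 : 0 < t%:C + 1 :> R[i] by rewrite ltr_wpDl// ler0c.
  move/(DZ _ _ (ltW _)) => /(_ (t%:C + 1)^-1); rewrite invr_gt0 => /(_ t1).
  by rewrite scalerA mulVf ?scale1r// gt_eqF.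
have DeP (t : R) : D (t%:C *: e) -> 0 <= t.
  move=> Dt; rewrite leNgt; apply/negP => t0; apply: De.
  have : D ((- t)^-1%:C *: (t%:C *: e)).
    by apply: DZ => //; rewrite ler0c invr_ge0 oppr_ge0 ltW.
  by rewrite scalerA -rmorphM invrN mulNr mulVf ?lt_eqF// rmorphN1 scaleN1r.
have DeZ (t : R) : 0 <= t -> D (t%:C *: e) by move=> t0; apply: DZ; rewrite ?ler0c.
pose S x := [set t : R | D (x - t%:C *: e)]; pose f x := sup (S x).
have Sub x (t s : R) : S x t -> D (s%:C *: e - x) -> t <= s.
  move=> St Ds; rewrite -subr_ge0; apply: DeP.
  have -> : (s - t)%:C *: e = s%:C *: e - x + (x - t%:C *: e).
    by rewrite subrKA -scalerBl -rmorphB.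
  exact: DD.
have hasS x : has_sup (S x).
  split; last by have [s Ds] := unitD x; exists s => t St; apply: Sub St Ds.
  have [s] := unitD (- x); exists (- s).
  by rewrite /S /= rmorphN scaleNr opprK addrC -[x]opprK.
have f_spec x (ep : R) : 0 < ep ->
    D (x - (f x - ep)%:C *: e) /\ D ((f x + ep)%:C *: e - x).
  move=> ep0; split.
    have [t St ft] := sup_adherent ep0 (hasS x).
    have -> : x - (f x - ep)%:C *: e = x - t%:C *: e + (t - (f x - ep))%:C *: e.
      by rewrite [in RHS]rmorphB scalerBl subrKA.
    by apply: DD => //; apply: DeZ; rewrite subr_ge0 ltW.
  have [|] := totD (x - (f x + ep)%:C *: e); last by rewrite opprB.
  move=> St; have := ub_le_sup (hasS x).2 St.
  by rewrite -/(f x) gerDl leNgt ep0.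
have f_unique x (c : R) : (forall ep, 0 < ep ->
    D (x - (c - ep)%:C *: e) /\ D ((c + ep)%:C *: e - x)) -> f x = c.
  move=> cP; apply/eqP; rewrite eq_le; apply/andP; split; apply/ler_addgt0Pr => ep ep0.
    by apply: ge_sup (hasS x).1 _ => t St; apply: Sub St (cP _ ep0).2.
  have Sc : S x (c - ep) by exact: (cP _ ep0).1.
  by have := ub_le_sup (hasS x).2 Sc; rewrite -/(f x) lerBlDr.
have fD x y : f (x + y) = f x + f y.
  apply: f_unique => ep ep0; have ep2 : 0 < ep / 2 by rewrite divr_gt0.
  have [x1 x2] := f_spec x _ ep2; have [y1 y2] := f_spec y _ ep2; split.
    have -> : f x + f y - ep = (f x - ep / 2) + (f y - ep / 2) by lra.
    by rewrite rmorphD scalerDl opprD addrACA; apply: DD.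
  have -> : f x + f y + ep = (f x + ep / 2) + (f y + ep / 2) by lra.
  by rewrite rmorphD scalerDl opprD addrACA; apply: DD.
have f0 : f 0 = 0 by apply: (addrI (f 0)); rewrite -fD !addr0.
have fN x : f (- x) = - f x.
  by apply/eqP; rewrite -addr_eq0 -fD addNr f0.
have fZ (t : R) x : 0 < t -> f (t%:C *: x) = t * f x.
  move=> t0; apply: f_unique => ep ep0; have [x1 x2] := f_spec x _ (divr_gt0 ep0 t0).
  split.
    have -> : t * f x - ep = t * (f x - ep / t) by field; rewrite gt_eqF.
    by rewrite rmorphM -scalerA -scalerBr; apply: DZ; rewrite // ler0c ltW.
  have -> : t * f x + ep = t * (f x + ep / t) by field; rewrite gt_eqF.
  by rewrite rmorphM -scalerA -scalerBr; apply: DZ; rewrite // ler0c ltW.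
exists f; split=> //.
- move=> t x; have [t0|t0|<-] := ltgtP 0 t; first exact: fZ.
    by rewrite -[t]opprK rmorphN scaleNr fN fZ ?mulNr// oppr_gt0.
  by rewrite scale0r f0 mul0r.
- move=> x /CD Dx; have S0 : S x 0 by rewrite /S /= scale0r subr0.
  by have := ub_le_sup (hasS x).2 S0.
- apply: f_unique => ep ep0; rewrite -[X in X - _]scale1r -[X in _ /\ D (_ - X)]scale1r.
  rewrite -!scalerBl -!(rmorph1 (real_complex R)) -!rmorphB.
  by split; apply: DeZ; lra.
Qed.

End Krein.

(** * States *)

Section States.
Variables (R : realType) (A : cstarAlgType R).
Implicit Types (a b e h x y : A) (s t : R[i]) (B C : set A) (phi : A -> R[i]).

(** The unit [e] of [B] may differ from [cone]: for [inner_span F] it will be the modulus of [z]. *)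
Definition unital_csub B e := [/\ closed_subalgebra B,
  forall a, B a -> B (star a), B e & forall a, B a -> e *c a = a].

Definition positive_linear B phi :=
  (forall (c : R[i]) a b, B a -> B b -> phi (c *: a + b) = c * phi a + phi b) /\
  (forall b, B b -> 0 <= phi (star b *c b)).

Lemma unital_csubT : unital_csub setT cone.
Proof.
by split; [split=> //; exact: closedT | | | move=> a _; exact: cmul1l].
Qed.

(** * Positive functionals on a subalgebra with its own unit *)

Section UnitalCsub.
Variables (B : set A) (e : A) (uB : unital_csub B e).

Let sB : closed_subalgebra B. Proof. by case: uB. Qed.
Let Be : B e. Proof. by case: uB. Qed.
Let Bs a : B a -> B (star a). Proof. by case: uB => _ Bs _ _; apply: Bs. Qed.

Lemma csub0 : B 0. Proof. by case: sB. Qed.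

Lemma unit_cmull a : B a -> e *c a = a.
Proof. by case: uB => _ _ _; apply. Qed.

Lemma star_unit : star e = e.
Proof.
have es : e *c star e = star e by apply/unit_cmull/Bs.
by have := congr1 star es; rewrite starM !starK es.
Qed.

Lemma unit_cmulr a : B a -> a *c e = a.
Proof.
by move=> /Bs/unit_cmull/(congr1 star); rewrite starM starK star_unit.
Qed.

Lemma norm_unit_le1 : `|e| <= 1.
Proof. by apply: norm_idem_le1; rewrite ?star_unit ?unit_cmull. Qed.

Lemma cpositive_unit : cpositive e.
Proof. by exists e; rewrite star_unit unit_cmull. Qed.

(** Compression of [s 1 - h] by the projection [e] turns [1] into [e] and fixes [h]. *)
Lemma cpositive_unit_subr h s : B h -> star h = h -> `|h| <= s ->
  cpositive (s *: e - h).
Proof.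
move=> Bh sh hs; have := cpositive_conj e (cpositive_subr sh hs).
rewrite star_unit cmulBr cmulBl cmulZr cmulZl cmul1r unit_cmull//.
by rewrite unit_cmull// unit_cmulr.
Qed.

Section PositiveLinear.
Variables (phi : A -> R[i]) (phi_pos : positive_linear B phi).

Lemma pos_lin0 : phi 0 = 0.
Proof.
have [lin _] := phi_pos; have := lin 1 0 0 csub0 csub0.
rewrite scale1r addr0 mul1r => h; apply: (addrI (phi 0)).
by rewrite -h addr0.
Qed.

Lemma pos_linD a b : B a -> B b -> phi (a + b) = phi a + phi b.
Proof.
by move=> Ba Bb; have [lin _] := phi_pos; rewrite -[a]scale1r lin// mul1r scale1r.
Qed.

Lemma pos_linZ t a : B a -> phi (t *: a) = t * phi a.
Proof.
move=> Ba; have [lin _] := phi_pos.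
by rewrite -[t *: a]addr0 lin ?pos_lin0 ?addr0//; exact: csub0.
Qed.

Lemma pos_linN a : B a -> phi (- a) = - phi a.
Proof. by move=> Ba; rewrite -scaleN1r pos_linZ// mulN1r. Qed.

Lemma pos_linB a b : B a -> B b -> phi (a - b) = phi a - phi b.
Proof.
by move=> Ba Bb; rewrite pos_linD ?pos_linN//; apply: (csubN sB).
Qed.

Lemma pos_lin_ge0 a : B a -> cpositive a -> 0 <= phi a.
Proof.
move=> Ba /cpositive_sqrt[k [/cpositive_sa sk kk kB]].
by have [_ pos] := phi_pos; have := pos _ (kB _ sB Ba); rewrite sk kk.
Qed.

Lemma pos_lin_le a b : B a -> B b -> cpositive (b - a) -> phi a <= phi b.
Proof.
by move=> Ba Bb; rewrite -subr_ge0 -pos_linB//; apply: pos_lin_ge0; apply: (csubB sB).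
Qed.

Lemma pos_lin_real h : B h -> star h = h -> phi h \is Num.real.
Proof.
move=> Bh sh; have Bt : B (`|h| *: e) := csubZ sB _ Be.
rewrite -[phi h](subKr (phi (`|h| *: e))) rpredB//.
  by rewrite pos_linZ// rpredM// ger0_real//; apply: pos_lin_ge0 cpositive_unit.
rewrite -pos_linB// ger0_real//; apply: pos_lin_ge0; first exact: (csubB sB).
exact: cpositive_unit_subr.
Qed.

Lemma pos_lin_star b : B b -> phi (star b) = Num.conj (phi b).
Proof.
move=> Bb; have Bsb := Bs Bb.
have r1 : phi (b + star b) \is Num.real.
  by apply: pos_lin_real; [exact: (csubD sB)|rewrite starD starK addrC].
have r2 : phi ('i *: (b - star b)) \is Num.real.
  apply: pos_lin_real; first by apply: (csubZ sB); exact: (csubB sB).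
  by rewrite starZ conjCi starB starK scaleNr -scalerN opprB.
move: r1 r2; rewrite pos_linD// pos_linZ ?pos_linB//; last exact: (csubB sB).
move: (phi b) (phi (star b)) => p q /CrealP r1 /CrealP r2.
rewrite rmorphD /= in r1; rewrite rmorphM rmorphB /= conjCi mulNr -mulrN opprB in r2.
have {}r2 := mulfI (neq0Ci _) r2.
apply/(can_inj conjCK); rewrite conjCK; apply: (@mulfI _ 2%:R).
  by rewrite pnatr_eq0.
transitivity ((Num.conj p + Num.conj q) + (Num.conj q - Num.conj p)); first by ring.
by rewrite r1 r2; ring.
Qed.

(** A phase [w] makes [phi (w b) = |phi b|]. The selfadjoint part [h] of [w b] has the same value
    under [phi] and norm at most 1, hence lies below [e]. *)
Lemma pos_lin_norm_le b : B b -> `|b| <= 1 -> `|phi b| <= phi e.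
Proof.
move=> Bb b1; have [->|p_neq0] := eqVneq (phi b) 0.
  by rewrite normr0; apply: pos_lin_ge0 cpositive_unit.
set p := phi b in p_neq0 *; pose w := Num.conj p / `|p|.
have np0 : `|p| != 0 by rewrite normr_eq0.
have wp : w * p = `|p|.
  by rewrite /w mulrAC [_ * p]mulrC -normCK expr2 mulfK.
have wp' : Num.conj w * Num.conj p = `|p|.
  by rewrite -rmorphM wp; apply/CrealP/normr_real.
have w1 : `|w| = 1 by rewrite /w normf_div normr_id norm_conjC divff.
have w1' : `|Num.conj w| = 1 by rewrite norm_conjC; exact: w1.
have bw : `|w *: b| <= 1 by rewrite normrZ w1 mul1r.
have bw' : `|Num.conj w *: star b| <= 1 by rewrite normrZ w1' mul1r norm_star.
pose h := 2%:R^-1 *: (w *: b + Num.conj w *: star b).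
have Bwb : B (w *: b) by exact: (csubZ sB).
have Bwb' : B (Num.conj w *: star b) by apply: (csubZ sB); exact: Bs.
have Bh : B h by apply: (csubZ sB); exact: (csubD sB).
have c2 : 0 <= 2%:R^-1 :> R[i] by rewrite invr_ge0 ler0n.
have sh : star h = h.
  by rewrite /h starZ_ge0// starD !starZ conjCK starK addrC.
have h1 : `|h| <= 1.
  rewrite normrZ ger0_norm// mulrC ler_pdivrMr ?ltr0n// mul1r.
  exact: le_trans (ler_normD _ _) (lerD bw bw').
suff <- : phi h = `|p|.
  apply: pos_lin_le => //; rewrite -[X in X - _]scale1r.
  exact: cpositive_unit_subr.
rewrite pos_linZ; last exact: (csubD sB).
rewrite pos_linD// !pos_linZ//; last exact: Bs.
by rewrite pos_lin_star// -/p wp wp'; field.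
Qed.

Lemma functional_normE : functional_norm B phi = complex.Re (phi e).
Proof.
have e0 : 0 <= phi e by apply: pos_lin_ge0 cpositive_unit.
apply/eqP; rewrite eq_le; apply/andP; split.
  apply: ge_sup.
    exists (complex.Re `|phi 0|), 0 => //; rewrite /= normr0 ler01.
    by split=> //; exact: csub0.
  move=> _ [b [Bb b1] <-]; have := pos_lin_norm_le Bb b1.
  by rewrite lecE => /andP[].
apply: ub_le_sup.
  exists (complex.Re (phi e)) => _ [b [Bb b1] <-].
  by have := pos_lin_norm_le Bb b1; rewrite lecE => /andP[].
by exists e; [split=> //; exact: norm_unit_le1|rewrite ger0_norm].
Qed.

End PositiveLinear.

Lemma state_onP phi :
  state_on B phi <-> positive_linear B phi /\ phi e = 1.
Proof.
split=> [[lin pos]|[[lin pos] pe]].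
  have pp : positive_linear B phi by split.
  rewrite (functional_normE pp) => pe; split=> //.
  have := pos_lin_ge0 pp Be cpositive_unit; case: (phi e) pe => u v /= ->.
  by rewrite lecE /= => /andP[/eqP-> _].
by split=> //; rewrite (functional_normE (conj lin pos)) pe.
Qed.

End UnitalCsub.

(** * Existence of states *)

(** Krein's theorem is applied to the preimage of [C] under [x |-> x + x^*]. This cone contains
    every skew-adjoint element with both signs, so the real functional [f] vanishes there, and
    [f x - i f (i x)] is a complex linear functional agreeing with [f] on selfadjoint elements. *)
Lemma state_of_cone C : convex_cone C -> (forall a, cpositive a -> C a) ->
  ~ C (- cone) ->
  exists2 phi, state_on setT phi & forall a, star a = a -> C a -> 0 <= phi a.
Proof.
move=> [C0 CD CZ] posC Ce; pose C1 := [set x | C (x + star x)].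
have coneC1 : convex_cone C1.
  split=> [|x y Cx Cy|t x t0 Cx]; rewrite /C1 /=.
  - by rewrite star0 addr0.
  - by rewrite starD addrACA; apply: CD.
  - by rewrite starZ_ge0// -scalerDr; apply: CZ.
have unitC1 x : exists2 t : R[i], 0 <= t & C1 (t *: cone - x).
  exists `|x| => //; apply: posC.
  have -> : `|x| *: cone - x + star (`|x| *: cone - x) =
      (`|x| + `|x|) *: cone - (x + star x).
    by rewrite starB starZ_ge0// star1 addrACA -scalerDl opprD.
  apply: cpositive_subr; first by rewrite starD starK addrC.
  by have := ler_normD x (star x); rewrite norm_star.
have C1e : ~ C1 (- cone).
  rewrite /C1 /= starN star1 => C2; apply: Ce.
  have -> : - cone = 2%:R^-1 *: (- cone - cone) :> A.
    by rewrite -mulr2n -(scaler_nat 2 (- cone)) scalerA mulVf ?scale1r// pnatr_eq0.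
  by apply: CZ; rewrite ?invr_ge0 ?ler0n.
have [f [fD fZ f_pos f1]] := krein_functional coneC1 unitC1 C1e.
have f0 : f 0 = 0 by apply: (addrI (f 0)); rewrite -fD !addr0.
have fN x : f (- x) = - f x by apply/eqP; rewrite -addr_eq0 -fD addNr f0.
pose phi x := (f x)%:C - 'i%R * (f ('i%R *: x))%:C.
have phi_sa h : star h = h -> phi h = (f h)%:C.
  move=> sh; have ih0 : 'i%R *: h + star ('i%R *: h) = 0.
    by rewrite starZ conjCi sh scaleNr subrr.
  rewrite /phi (_ : f ('i%R *: h) = 0) ?mulr0 ?subr0//.
  apply/eqP; rewrite eq_le -[_ <= 0]oppr_ge0 -fN !f_pos//; rewrite /C1 /=.
    by rewrite ih0.
  by rewrite starN -opprD ih0 oppr0.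
have phi_ge0 a : star a = a -> C a -> 0 <= phi a.
  by move=> sa Ca; rewrite phi_sa// ler0c f_pos// /C1 /= sa; apply: CD.
exists phi => //; apply/(state_onP unital_csubT); split; last first.
  by rewrite phi_sa ?star1// f1.
split=> [c a b _ _|b _]; last first.
  by apply: phi_ge0; [rewrite starM starK|apply: posC; exists b].
have phiD x y : phi (x + y) = phi x + phi y.
  by rewrite /phi scalerDr !fD !rmorphD /=; ring.
have phiZ (t : R) x : phi (t%:C *: x) = t%:C * phi x.
  by rewrite /phi scalerA ['i%R * t%:C]mulrC -scalerA !fZ !rmorphM /=; ring.
have phii x : phi ('i%R *: x) = 'i%R * phi x.
  rewrite /phi scalerA -expr2 sqrCi scaleN1r fN rmorphN mulrBr mulrA -expr2 sqrCi.
  by rewrite mulN1r opprK mulrN opprK addrC.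
rewrite phiD; congr (_ + _).
rewrite [c]complexE complexiE scalerDl phiD phiZ -scalerA phii phiZ.
by rewrite mulrDl mulrA.
Qed.

(** A state nonnegative at [a - 1] takes the value 1 at [a], since [a <= 1]. It exists unless
    [- 1 = p + s (a - 1)] with [p] positive, that is [s a <= s - 1]: for [s >= 1] the norms give
    [s <= s - 1], and for [s < 1] both signs of [(1 - s) 1] are positive, so the algebra is zero,
    against [|a| = 1]. *)
Lemma norming_state a : cpositive a -> `|a| = 1 ->
  exists2 phi, state_on setT phi & phi a = 1.
Proof.
move=> pa a1; pose C := [set x | exists p s, [/\ cpositive p, 0 <= s &
  x = p + s *: (a - cone)]].
have coneC : convex_cone C.
  split=> [|_ _ [p [s [pp s0 ->]]] [q [t [pq t0 ->]]]|t _ t0 [p [s [pp s0 ->]]]].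
  - by exists 0, 0; rewrite scale0r addr0; split=> //; exact: cpositive0.
  - exists (p + q), (s + t); rewrite addr_ge0// scalerDl addrACA.
    by split=> //; exact: cpositiveD.
  - exists (t *: p), (t * s); rewrite mulr_ge0// scalerDr scalerA.
    by split=> //; exact: cpositiveZ.
have posC p : cpositive p -> C p.
  by move=> pp; exists p, 0; rewrite scale0r addr0.
have Ce : ~ C (- cone).
  move=> [p [s [pp s0 pe]]].
  have pE : (s - 1) *: cone - s *: a = p.
    by rewrite scalerBl scale1r -addrA [- cone - _]addrC addrA -scalerBr
      pe -opprB scalerN addrCA addNr addr0.
  have psa : cpositive (s *: a) by exact: cpositiveZ.
  have [s1|s1] := boolP (0 <= s - 1).
    have : `|s *: a| <= s - 1 by apply: norm_cpositive_le => //; rewrite pE.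
    by rewrite normrZ a1 mulr1 ger0_norm// lerDl oppr_ge0 ler10.
  have {}s1 : 0 < 1 - s.
    by rewrite -opprB oppr_gt0 real_ltNge ?rpredB ?rpred1 ?rpred0 ?ger0_real.
  have cone0 : (1 - s) *: cone = 0 :> A.
    apply: cpositive_anti.
      by apply: cpositiveZ; [exact: ltW|exact: cpositive_cone].
    rewrite -scaleNr opprB -[_ *: cone](subrK (s *: a)) pE.
    exact: cpositiveD.
  have a0 : a = 0.
    rewrite -[a]cmul1l -[cone]scale1r -(mulVf (lt0r_neq0 s1)) -scalerA cone0.
    by rewrite scaler0 cmul0l.
  by move/eqP: a1; rewrite a0 normr0 eq_sym oner_eq0.
have [phi st phi_pos] := state_of_cone coneC posC Ce.
exists phi => //; have /(state_onP unital_csubT)[pp p1] := st.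
apply/eqP; rewrite eq_le; apply/andP; split.
  rewrite -p1; apply: (pos_lin_le unital_csubT pp) => //.
  rewrite -[X in X - _]scale1r.
  by apply: cpositive_subr; [exact: cpositive_sa|rewrite a1].
have := phi_pos (a - cone).
rewrite (pos_linB unital_csubT pp)// p1 subr_ge0; apply.
  by rewrite starB star1 cpositive_sa.
by exists 0, 1; rewrite scale1r add0r ler01; split=> //; exact: cpositive0.
Qed.

End States.

(** * Ternary subspaces *)

Section LinearSpan.
Variables (R : realType) (V : lmodType R[i]) (S : set V).
Implicit Types (P : set V) (a b : V).

Lemma linear_span_ind P :
  P 0 -> (forall (k : R[i]) a b, P a -> P b -> P (k *: a + b)) ->
  S `<=` P -> linear_span S `<=` P.
Proof.
move=> P0 Plin SP _ [n [c [s [Ss ->]]]].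
elim/big_ind : _ => // [a b Pa Pb|i _]; first by rewrite -[a]scale1r; apply: Plin.
by rewrite -[_ *: _]addr0; apply: Plin => //; apply: SP.
Qed.

Lemma linear_span_lin (k : R[i]) a b :
  linear_span S a -> linear_span S b -> linear_span S (k *: a + b).
Proof.
move=> [n [c [s [Ss ->]]]] [m [d [t [St ->]]]].
exists (n + m)%N,
  (fun i => match fintype.split i with inl j => k * c j | inr j => d j end),
  (fun i => match fintype.split i with inl j => s j | inr j => t j end).
split=> [i|]; first by case: (fintype.split i).
rewrite big_split_ord /= scaler_sumr; congr (_ + _); apply: eq_bigr => i _.
  by rewrite (unsplitK (inl i)) scalerA.
by rewrite (unsplitK (inr i)).
Qed.

Lemma linear_span_sub : S `<=` linear_span S.
Proof.
move=> a Sa; exists 1%N, (fun=> 1), (fun=> a); split=> //.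
by rewrite big_ord1 scale1r.
Qed.

Lemma linear_span0 : linear_span S 0.
Proof.
by exists 0%N, (fun=> 0), (fun=> 0); split=> [[]//|]; rewrite big_ord0.
Qed.

End LinearSpan.

Section HilbertModules.
Variables (R : realType) (A : cstarAlgType R) (E : hilbertModType A).
Implicit Types (a b : A) (x y z : E) (P : set A).

Lemma inner_actl x y a : inner (act x a) y = star a *c inner x y.
Proof. by rewrite -inner_star inner_act starM inner_star. Qed.

Lemma modulusP x : cpositive (modulus x) /\ modulus x *c modulus x = inner x x.
Proof. exact/csqrtP/inner_positive. Qed.

Lemma norm_modulus x : `|modulus x| = `|x|.
Proof.
have [px xx] := modulusP x.
by rewrite hilbert_norm -xx norm_sqr_sa ?cpositive_sa// sqrCK.
Qed.

Section InnerSpan.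
Variable F : set E.
Local Notation B := (inner_span F).

Lemma inner_span_inner x y : F x -> F y -> B (inner x y).
Proof.
by move=> Fx Fy; apply/subset_closure/linear_span_sub; exists x => //; exists y.
Qed.

Lemma inner_span_ind P : closed P -> P 0 ->
  (forall (k : R[i]) a b, P a -> P b -> P (k *: a + b)) ->
  (forall x y, F x -> F y -> P (inner x y)) -> B `<=` P.
Proof.
move=> clP P0 Plin Pin; rewrite (closure_id P).1//; apply: closureS.
by apply: linear_span_ind => // _ [x Fx [y Fy <-]]; apply: Pin.
Qed.

Lemma closed_inner_span : closed B. Proof. exact: closed_closure. Qed.

Lemma inner_span0 : B 0. Proof. exact/subset_closure/linear_span0. Qed.

(** The closure is handled one variable at a time: first [a] is reduced to the span with [b] fixed
    in [B], then [b]. *)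
Lemma inner_span_lin (k : R[i]) a b : B a -> B b -> B (k *: a + b).
Proof.
set S := linear_span [set inner x y | x in F & y in F].
have closed_pre (f : A -> A) : continuous f -> closed (f @^-1` B).
  by move=> cf; apply: preimage_closed closed_inner_span => u _; exact: cf.
have sub_pre (f : A -> A) : continuous f -> S `<=` f @^-1` B -> B `<=` f @^-1` B.
  move=> cf /closureS; rewrite -((closure_id _).1 (closed_pre f cf)).
  exact.
move=> Ba Bb.
have cl c : continuous (fun a => k *: a + c).
  apply: (@lipschitz_continuous _ _ _ _ `|k|) => // u v.
  by rewrite opprD addrACA subrr addr0 -scalerBr normrZ.
have cr c : continuous (fun b => k *: c + b).
  apply: (@lipschitz_continuous _ _ _ _ 1) => // u v.
  by rewrite opprD addrACA subrr add0r mul1r.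
apply: (sub_pre _ (cl b)) Ba => a' Sa' /=.
apply: (sub_pre _ (cr a')) Bb => b' Sb' /=.
exact/subset_closure/linear_span_lin.
Qed.

Hypothesis ternary_F : ternary F.

(** Ternarity enters through [<x, y> b = <x, y b>] with [y b] again in [F]. Hence only the left
    factor of a product has to be approximated by the span. *)
Lemma inner_span_csub : closed_subalgebra B.
Proof.
have [_ _ actF] := ternary_F.
have Bin x y b : F x -> F y -> B b -> B (inner x y *c b).
  by move=> Fx Fy Bb; rewrite -inner_act; apply: inner_span_inner => //; apply: actF.
split; [exact: closed_inner_span|exact: inner_span_lin|exact: inner_span0|].
move=> a b Ba Bb.
suff: B `<=` (fun a => a *c b) @^-1` B by apply.
apply: inner_span_ind => [||k u v Bu Bv|x y Fx Fy] /=.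
- apply: preimage_closed closed_inner_span => u _; exact: cmulr_continuous.
- by rewrite cmul0l; exact: inner_span0.
- by rewrite cmulDl cmulZl; exact: inner_span_lin.
- exact: Bin.
Qed.

Lemma inner_span_star a : B a -> B (star a).
Proof.
move: a; apply: inner_span_ind => [||k u v Bu Bv|x y Fx Fy] /=.
- apply: preimage_closed closed_inner_span => u _; exact: star_continuous.
- by rewrite star0; exact: inner_span0.
- by rewrite starD starZ; exact: inner_span_lin.
- by rewrite inner_star; exact: inner_span_inner.
Qed.

Lemma inner_span_modulus x : F x -> B (modulus x).
Proof.
move=> Fx; apply: (csqrt_csub inner_span_csub (inner_positive _)).
exact: inner_span_inner.
Qed.

Variable z : E.
Hypotheses (Fz : F z) (unit_z : forall a, B a -> modulus z *c a = a).

Lemma inner_span_unital : unital_csub B (modulus z).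
Proof.
split=> //; [exact: inner_span_csub|exact: inner_span_star|].
exact: inner_span_modulus.
Qed.

(** As [<z a, z a> = a |z|^2 a = a^2], every positive element of [B] is the modulus of a vector of
    [F]. This turns conditions on moduli into conditions on the positive part of [B]. *)
Lemma modulus_act a : B a -> cpositive a -> F (act z a) /\ modulus (act z a) = a.
Proof.
move=> Ba pa; have [_ _ actF] := ternary_F; split; first exact: actF.
apply: csqrt_unique => //; rewrite inner_act inner_actl -(modulusP z).2.
by rewrite cpositive_sa// -!cmulA !unit_z.
Qed.

End InnerSpan.
End HilbertModules.

(** * States peaking at vectors of a ternary subspace with unit *)

Section TernaryUnital.
Variables (R : realType) (A : cstarAlgType R) (E : hilbertModType A).
Variables (F : set E) (z : E) (ternary_F : ternary F) (Fz : F z).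
Local Notation B := (inner_span F).
Local Notation e := (modulus z).
Hypothesis unit_z : forall a, B a -> e *c a = a.
Implicit Types (a b : A) (x y : E) (phi psi : A -> R[i]) (m M : R).

Let uB : unital_csub B e := inner_span_unital ternary_F Fz unit_z.

Let sB : closed_subalgebra B. Proof. by case: uB. Qed.

Let Be : B e. Proof. by case: uB. Qed.

(** A state of the whole algebra norming [|x|] restricts to a state of [B]: its value at [e] is
    squeezed by [|x| <= e <= 1]. *)
Lemma norming_state_on x : F x -> `|x| = 1 ->
  exists2 psi, state_on B psi & psi (modulus x) = 1.
Proof.
move=> Fx x1; have [pa _] := modulusP x; have Ba := inner_span_modulus ternary_F Fx.
have a1 : `|modulus x| = 1 by rewrite norm_modulus.
have [psi /(state_onP (unital_csubT A))[pp p1] psi_a] := norming_state pa a1.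
exists psi => //; apply/(state_onP uB).
have ppB : positive_linear B psi.
  by case: pp => lin pos; split=> [c a b _ _|b _]; [apply: lin|apply: pos].
split=> //; apply/eqP; rewrite eq_le; apply/andP; split.
  rewrite -p1; apply: (pos_lin_le (unital_csubT A) pp) => //.
  rewrite -[X in X - _]scale1r; apply: cpositive_subr (norm_unit_le1 uB).
  exact: star_unit uB.
rewrite -psi_a; apply: (pos_lin_le uB ppB) => //.
rewrite -[X in X - _]scale1r; apply: (cpositive_unit_subr uB) => //.
  exact: cpositive_sa.
by rewrite a1.
Qed.

(* [c = |z| - |x|] is the modulus of [z c], and [psi c = 0] forces
   [psi (c^2) = 0], hence [phi c = 0]. *)
Lemma module_independent_peak m M phi psi x : F x -> `|x| = 1 ->
  state_on setT phi -> state_on B psi -> psi (modulus x) = 1 ->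
  (forall y, F y -> m%:C * psi (modulus y) <= phi (modulus y) /\
     phi (modulus y) <= M%:C * sqrtC (psi (modulus y *c modulus y))) ->
  [/\ m%:C <= phi (modulus x), phi (modulus x) = phi e & phi e <= M%:C].
Proof.
move=> Fx x1 /(state_onP (unital_csubT A))[pphi phi1] /(state_onP uB)[ppsi psi1].
move=> psi_x mM.
have [pa _] := modulusP x; have Ba := inner_span_modulus ternary_F Fx.
set a := modulus x in psi_x pa Ba *.
have a1 : `|a| = 1 by rewrite norm_modulus.
have ea_pos : cpositive (e - a).
  rewrite -[X in X - _]scale1r; apply: (cpositive_unit_subr uB) => //.
    exact: cpositive_sa.
  by rewrite a1.
have Bea : B (e - a) := csubB sB Be Ba.
have [Fy yE] := modulus_act ternary_F Fz unit_z Bea ea_pos.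
have psi_ea : psi (e - a) = 0 by rewrite (pos_linB uB ppsi)// psi1 psi_x subrr.
have ee : e *c e = e := unit_z Be.
have ae : a *c e = a := unit_cmulr uB Ba.
have ea : e *c a = a := unit_z Ba.
have sq_ea : e - a - (e - a) *c (e - a) = a - a *c a.
  by rewrite cmulBl !cmulBr ee ae ea subKr.
have psi_sq : psi ((e - a) *c (e - a)) = 0.
  have Bsq := csubM sB Bea Bea.
  have sea := cpositive_sa ea_pos.
  apply/eqP; rewrite eq_le; apply/andP; split.
    rewrite -psi_ea; apply: (pos_lin_le uB ppsi) => //.
    (* The difference [a - a^2] equals [k (e - a) k] with [k] the square root of [a], hence is
       positive. *)
    rewrite sq_ea; have [k [/cpositive_sa sk kk kB]] := cpositive_sqrt pa.
    have := cpositive_conj k ea_pos; rewrite sk.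
    have ke : k *c e = k := unit_cmulr uB (kB _ sB Ba).
    by rewrite cmulBr ke cmulBl kk -kk !cmulA.
  by have [_ pos] := ppsi; have := pos _ Bea; rewrite sea.
have phi_ea : phi e - phi a = 0.
  rewrite -(pos_linB (unital_csubT A) pphi)//; apply/eqP; rewrite eq_le.
  rewrite (pos_lin_ge0 (unital_csubT A) pphi)// andbT.
  by have [_] := mM _ Fy; rewrite yE psi_sq sqrtC0 mulr0.
have phi_a : phi a = phi e by apply/esym/eqP; rewrite -subr_eq0 phi_ea.
have [mx _] := mM _ Fx; have [_ Mz] := mM _ Fz.
split=> //; first by move: mx; rewrite -/a psi_x mulr1.
by move: Mz; rewrite ee psi1 sqrtC1 mulr1.
Qed.

(** The variance [psi ((a - t e)^2) = psi (a^2) - t^2], with [t = psi a], is nonnegative. This turns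
    an upper bound by [M psi (|x|)] into the one by [M psi (|x|^2)^(1/2)]. *)
Lemma state_sqr_le psi a : state_on B psi -> B a -> cpositive a ->
  psi a <= sqrtC (psi (a *c a)).
Proof.
move=> /(state_onP uB)[ppsi psi1] Ba pa; have sa := cpositive_sa pa.
set t := psi a; have t0 : 0 <= t := pos_lin_ge0 uB ppsi Ba pa.
rewrite -(sqrCK t0) ler_sqrtC ?nnegrE ?exprn_ge0//; last first.
  by have [_ pos] := ppsi; have := pos _ Ba; rewrite sa.
have Bte : B (t *: e) := csubZ sB _ Be; have Bta : B (t *: a) := csubZ sB _ Ba.
have Baa : B (a *c a) := csubM sB Ba Ba.
have Bate : B (a - t *: e) := csubB sB Ba Bte.
have [_ pos] := ppsi; have := pos _ Bate.
rewrite starB sa starZ_ge0// (star_unit uB).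
have -> : (a - t *: e) *c (a - t *: e) = a *c a - t *: a - t *: (a - t *: e).
  rewrite cmulBl !cmulBr cmulZr cmulZl cmulZr cmulZl (unit_cmulr uB Ba).
  by rewrite (unit_cmull uB Ba) (unit_cmull uB Be) scalerBr.
rewrite (pos_linB uB ppsi); [|exact: (csubB sB)|exact: (csubZ sB)].
rewrite (pos_linB uB ppsi)// !(pos_linZ uB ppsi)// (pos_linB uB ppsi)//.
by rewrite (pos_linZ uB ppsi)// psi1 -/t mulr1 subrr mulr0 subr0 subr_ge0 expr2.
Qed.

(* The witness is [z g / |g|] where [g = (a - b) + T |z|] is positive: a state
   peaking there takes its largest possible value [|g| - T] at [a - b], up to
   the factor [phi |z|]. *)
Lemma peak_witness psi a b : state_on B psi -> B a -> B b ->
  cpositive a -> cpositive b ->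
  exists x, [/\ F x, `|x| = 1 & forall phi m M, 0 < m -> 0 < M ->
    state_on setT phi -> m%:C <= phi (modulus x) -> phi (modulus x) = phi e ->
    phi e <= M%:C -> m%:C * psi a - M%:C * psi b <= phi (a - b)].
Proof.
move=> /(state_onP uB)[ppsi psi1] Ba Bb pa pb; pose h := a - b.
have Bh : B h := csubB sB Ba Bb.
have sh : star h = h by rewrite starB !cpositive_sa.
(* The summand 1 gives [g >= e], so that [psi g >= 1] and [g] can be normalized. *)
pose T := `|h| + 1; have T0 : 0 <= T by rewrite addr_ge0.
pose g := T *: e + h; have Bg : B g := csubD sB (csubZ sB _ Be) Bh.
have ge_pos : cpositive (g - e).
  rewrite /g /T scalerDl scale1r addrAC addrK -[h in X in cpositive X]opprK.
  by apply: (cpositive_unit_subr uB); rewrite ?normrN ?starN ?sh//; apply: (csubN sB).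
have g_pos : cpositive g.
  by rewrite -[g](subrK e); apply: cpositiveD => //; apply: cpositive_unit uB.
have psi_g : 1 <= psi g by rewrite -psi1; apply: (pos_lin_le uB ppsi).
have g_neq0 : `|g| != 0.
  rewrite normr_eq0; apply/eqP => g0; move: psi_g.
  by rewrite g0 (pos_lin0 uB ppsi) ler10.
have gi0 : 0 <= `|g|^-1 by rewrite invr_ge0.
have By : B (`|g|^-1 *: g) := csubZ sB _ Bg.
have [Fx xE] := modulus_act ternary_F Fz unit_z By (cpositiveZ gi0 g_pos).
exists (act z (`|g|^-1 *: g)); split=> //.
  by rewrite -norm_modulus xE normrZ ger0_norm// mulVf.
move=> phi m M m0 M0 /(state_onP (unital_csubT A))[pphi phi1]; rewrite xE.
rewrite (pos_linZ (unital_csubT A) pphi)// => ms phi_s sM.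
set s := phi e in phi_s sM.
have phi_g : phi g = `|g| * s by rewrite -phi_s mulVKf.
have phi_h : phi h = (`|g| - T) * s.
  have -> : h = g - T *: e by rewrite /g addrC addKr.
  rewrite (pos_linB (unital_csubT A) pphi)// (pos_linZ (unital_csubT A) pphi)//.
  by rewrite phi_g mulrBl.
have psi_h : psi a - psi b <= `|g| - T.
  rewrite -(pos_linB uB ppsi)// -/h.
  have -> : h = g - T *: e by rewrite /g addrC addKr.
  rewrite (pos_linB uB ppsi)//; last exact: (csubZ sB).
  rewrite (pos_linZ uB ppsi)// psi1 mulr1 lerD2r.
  rewrite -[`|g|]mulr1 -psi1 -(pos_linZ uB ppsi)//.
  apply: (pos_lin_le uB ppsi) => //; first exact: (csubZ sB).
  by apply: (cpositive_unit_subr uB) => //; exact: cpositive_sa.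
have s0 : 0 <= s.
  by rewrite -phi_s; apply: le_trans ms; rewrite ler0c ltW.
(* Since [s] lies between [m] and [M] and both [psi a] and [psi b] are nonnegative,
   [(psi a - psi b) s >= m psi a - M psi b]. *)
rewrite -/h phi_h; apply: le_trans (_ : (psi a - psi b) * s <= _).
  rewrite mulrBl; apply: lerB; rewrite [leRHS]mulrC.
    by rewrite ler_wpM2r ?(pos_lin_ge0 uB ppsi)// -phi_s.
  by rewrite ler_wpM2l ?(pos_lin_ge0 uB ppsi).
by rewrite ler_wpM2r.
Qed.

End TernaryUnital.

(** * The cone encoding the bounds by [m psi] and [M psi] *)

Section StateCone.
Variables (R : realType) (A : cstarAlgType R) (B : set A) (e : A).
Hypothesis uB : unital_csub B e.
Variables (psi : A -> R[i]) (state_psi : state_on B psi) (m M : R).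
Implicit Types (a b : A) (phi : A -> R[i]).

Let sB : closed_subalgebra B.
Proof. by case: uB. Qed.

Let psi_pos : positive_linear B psi.
Proof. by have [] := (state_onP uB psi).1 state_psi. Qed.

(* A state is nonnegative on this cone iff it lies between [m psi] and [M psi]
   on the positive part of [B]. *)
Definition state_cone : set A := [set x | exists a b,
  [/\ B a, B b, cpositive a, cpositive b &
      x = a - b - (m%:C * psi a - M%:C * psi b) *: cone]].

Lemma convex_state_cone : convex_cone state_cone.
Proof.
have psi0 := pos_lin0 uB psi_pos.
split=> [|_ _ [a [b [Ba Bb pa pb ->]]] [c [d [Bc Bd pc pd ->]]]|].
- exists 0, 0; rewrite psi0 !mulr0 !subr0 scale0r subr0.
  by split=> //; (exact: csub0 uB || exact: cpositive0).
- exists (a + c), (b + d); split;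
    [exact: (csubD sB)|exact: (csubD sB)|exact: cpositiveD|exact: cpositiveD|].
  rewrite !(pos_linD psi_pos)// addrACA [a - b + _]addrACA -!opprD -scalerDl.
  by congr (_ - _ *: _); ring.
- move=> t _ t0 [a [b [Ba Bb pa pb ->]]]; exists (t *: a), (t *: b).
  split; [exact: (csubZ sB)|exact: (csubZ sB)|exact: cpositiveZ|exact: cpositiveZ|].
  rewrite !(pos_linZ uB psi_pos)// scalerBr scalerBr scalerA; congr (_ - _ *: _).
  by ring.
Qed.

(** The pairs [(a, 0)] and [(0, a)] put [a - m psi (a) 1] and [M psi (a) 1 - a] in the cone. *)
Lemma state_cone_bounds phi a :
  (forall h, star h = h -> state_cone h -> 0 <= phi h) -> state_on setT phi ->
  B a -> cpositive a ->
  m%:C * psi a <= phi a /\ phi a <= M%:C * psi a.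
Proof.
move=> phi_pos /(state_onP (unital_csubT A))[pphi phi1] Ba pa.
have psi0 := pos_lin0 uB psi_pos; have B0 : B 0 := csub0 uB.
have psi_real : psi a \is Num.real.
  by apply: (pos_lin_real uB psi_pos) => //; exact: cpositive_sa.
have real_real (r : R) : r%:C \is Num.real by apply/complex_realP; exists r.
have star_cone (t : R[i]) : t \is Num.real -> star (t *: cone) = t *: cone :> A.
  by move=> /CrealP rt; rewrite starZ rt star1.
split.
  have := phi_pos (a - (m%:C * psi a) *: cone).
  rewrite (pos_linB (unital_csubT A) pphi)// (pos_linZ (unital_csubT A) pphi)//.
  rewrite phi1 mulr1 subr_ge0; apply.
    by rewrite starB (cpositive_sa pa) star_cone// rpredM.
  exists a, 0; rewrite subr0 psi0 mulr0 subr0; split=> //; exact: cpositive0.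
have := phi_pos ((M%:C * psi a) *: cone - a).
rewrite (pos_linB (unital_csubT A) pphi)// (pos_linZ (unital_csubT A) pphi)//.
rewrite phi1 mulr1 subr_ge0; apply.
  by rewrite starB (cpositive_sa pa) star_cone// rpredM.
exists 0, a; rewrite !sub0r psi0 mulr0 sub0r scaleNr opprK addrC.
by split=> //; exact: cpositive0.
Qed.

End StateCone.

Definition cone_add (R : realType) (V : lmodType R[i]) (C D : set V) : set V :=
  [set z | exists x y, [/\ C x, D y & z = x + y]].

Lemma convex_cone_add (R : realType) (V : lmodType R[i]) (C D : set V) :
  convex_cone C -> convex_cone D -> convex_cone (cone_add C D).
Proof.
move=> [C0 CD CZ] [D0 DD DZ].
split=> [|_ _ [x [y [Cx Dy ->]]] [x' [y' [Cx' Dy' ->]]]|t _ t0 [x [y [Cx Dy ->]]]].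
- by exists 0, 0; rewrite addr0.
- by exists (x + x'), (y + y'); rewrite addrACA; split=> //; [apply: CD|apply: DD].
- by exists (t *: x), (t *: y); rewrite scalerDr; split=> //; [apply: CZ|apply: DZ].
Qed.

Lemma convex_cpositive (R : realType) (A : cstarAlgType R) :
  convex_cone (@cpositive R A).
Proof.
split; [exact: cpositive0|exact: cpositiveD|exact: cpositiveZ].
Qed.

Theorem theorem3p3 (R : realType) (A : cstarAlgType R) (E : hilbertModType A)
    (E1 E2 : set E) (ternary1 : ternary E1) (ternary2 : ternary E2)
    (z1 z2 : E) (Ez1 : E1 z1) (Ez2 : E2 z2)
    (unit1 : forall a : A, inner_span E1 a -> modulus z1 *c a = a)
    (unit2 : forall a : A, inner_span E2 a -> modulus z2 *c a = a) :
  module_independent E1 E2 <->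
  exists m M : R, [/\ 0 < m, 0 < M &
    forall x1 x2 : E, E1 x1 -> E2 x2 -> `|x1| = 1 -> `|x2| = 1 ->
      exists phi : A -> R[i], [/\ state_on setT phi,
        [/\ m%:C <= phi (modulus x1), phi (modulus x1) = phi (modulus z1)
          & phi (modulus z1) <= M%:C] &
        [/\ m%:C <= phi (modulus x2), phi (modulus x2) = phi (modulus z2)
          & phi (modulus z2) <= M%:C]]].
Proof.
have uB1 := inner_span_unital ternary1 Ez1 unit1.
have uB2 := inner_span_unital ternary2 Ez2 unit2.
split=> -[m [M [m0 M0 H]]]; exists m, M; split=> //.
  move=> x1 x2 Ex1 Ex2 n1 n2.
  have [psi1 st1 psi_x1] := norming_state_on ternary1 Ez1 unit1 Ex1 n1.
  have [psi2 st2 psi_x2] := norming_state_on ternary2 Ez2 unit2 Ex2 n2.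
  have [phi [st H1 H2]] := H _ _ st1 st2; exists phi; split=> //.
    exact: (module_independent_peak ternary1 Ez1 unit1 Ex1 n1 st st1 psi_x1 H1).
  exact: (module_independent_peak ternary2 Ez2 unit2 Ex2 n2 st st2 psi_x2 H2).
move=> psi1 psi2 st1 st2.
pose K1 := state_cone (inner_span E1) psi1 m M.
pose K2 := state_cone (inner_span E2) psi2 m M.
have cK1 : convex_cone K1 := convex_state_cone uB1 st1 m M.
have cK2 : convex_cone K2 := convex_state_cone uB2 st2 m M.
have [K10 _ _] := cK1; have [K20 _ _] := cK2.
pose K := cone_add (@cpositive R A) (cone_add K1 K2).
have K_pos a : cpositive a -> K a.
  move=> pa; exists a, 0; rewrite addr0; split=> //.
  by exists 0, 0; rewrite addr0.
have K1K : K1 `<=` K.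
  move=> a Ka; exists 0, a; rewrite add0r; split=> //; first exact: cpositive0.
  by exists a, 0; rewrite addr0.
have K2K : K2 `<=` K.
  move=> a Ka; exists 0, a; rewrite add0r; split=> //; first exact: cpositive0.
  by exists 0, a; rewrite add0r.
have cK : convex_cone K.
  by do 2?apply: convex_cone_add => //; exact: convex_cpositive.
have K_cone : ~ K (- cone).
  move=> [p [_ [pp [c1 [c2 [[a1 [b1 [Ba1 Bb1 pa1 pb1 ->]]]
    [a2 [b2 [Ba2 Bb2 pa2 pb2 ->]]] ->]]]]]] pE.
  (* The witnesses are chosen before any state [phi], so a single [phi] from [H] serves both
     subspaces. It is nonnegative on the three summands of [pE], whereas [phi (- cone) = - 1]. *)
  have [x1 [Ex1 n1 P1]] :=
    peak_witness ternary1 Ez1 unit1 st1 Ba1 Bb1 pa1 pb1.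
  have [x2 [Ex2 n2 P2]] :=
    peak_witness ternary2 Ez2 unit2 st2 Ba2 Bb2 pa2 pb2.
  have [phi [st [m1 e1 M1] [m2 e2 M2]]] := H _ _ Ex1 Ex2 n1 n2.
  have {P1} le1 := P1 _ _ _ m0 M0 st m1 e1 M1.
  have {P2} le2 := P2 _ _ _ m0 M0 st m2 e2 M2.
  have [pphi phi1] := (state_onP (unital_csubT A) phi).1 st.
  have phi_sub (c : A) (k : R[i]) : k <= phi c -> 0 <= phi (c - k *: cone).
    move=> kc; rewrite (pos_linB (unital_csubT A) pphi)//.
    by rewrite (pos_linZ (unital_csubT A) pphi)// phi1 mulr1 subr_ge0.
  have : 0 <= phi (- cone).
    rewrite pE (pos_linD pphi)// [phi (_ + (_ - _))](pos_linD pphi)//.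
    by rewrite !addr_ge0// ?phi_sub//; exact: (pos_lin_ge0 (unital_csubT A) pphi).
  by rewrite (pos_linN (unital_csubT A) pphi)// phi1 oppr_ge0 ler10.
have [phi st phi_pos] := state_of_cone cK K_pos K_cone.
exists phi; split=> // x Ex; have [px _] := modulusP x.
- have Bx := inner_span_modulus ternary1 Ex.
  have phi_pos1 h : star h = h -> K1 h -> 0 <= phi h.
    by move=> sh /K1K; apply: phi_pos.
  have [lo up] := state_cone_bounds uB1 st1 phi_pos1 st Bx px; split=> //.
  apply: le_trans up _; rewrite ler_wpM2l ?ler0c ?(ltW M0)//.
  exact: (state_sqr_le ternary1 Ez1 unit1).
- have Bx := inner_span_modulus ternary2 Ex.
  have phi_pos2 h : star h = h -> K2 h -> 0 <= phi h.
    by move=> sh /K2K; apply: phi_pos.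
  have [lo up] := state_cone_bounds uB2 st2 phi_pos2 st Bx px; split=> //.
  apply: le_trans up _; rewrite ler_wpM2l ?ler0c ?(ltW M0)//.
  exact: (state_sqr_le ternary2 Ez2 unit2).
Qed.
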